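(* Let $p>1$, $q>1$ be such that $p^{-1}+q^{-1}>1$. Then there exists a constant $D_{p,q}<+\infty$, depending on $p$ and $q$ only, such that for all Banach spaces $E,V$, all real $a<b$, and all $f\in\mathcal{U}^{p}([a,b],L(E,V))$ and $g\in\mathcal{U}^{q}([a,b],E)$ which have no common points of discontinuity, $$\left\|\int_{a}^{\cdot}[f(s)-f(a)]\,\mathrm{d}g(s)\right\|_{q\text{-TV},[a,b]}\le D_{p,q}\,\|f\|_{p\text{-TV},[a,b]}^{p-p/q}\,\|f\|_{\mathrm{osc},[a,b]}^{1+p/q-p}\,\|g\|_{q\text{-TV},[a,b]},$$ where $\int_{a}^{\cdot}[f(s)-f(a)]\,\mathrm{d}g(s)$ denotes the function $[a,b]\ni t\mapsto\int_{a}^{t}[f(s)-f(a)]\,\mathrm{d}g(s)\in V$ given by Riemann-Stieltjes integrals.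
   Context: $L(E,V)$ is the Banach space of continuous linear maps $E\to V$ with the operator norm. For a Banach space $W$, $h:[a,b]\to W$ and $\delta\ge0$, the truncated variation is $$\mathrm{TV}^{\delta}(h,[a,b]):=\sup_{n}\ \sup_{a\le t_{0}<t_{1}<\ldots<t_{n}\le b}\ \sum_{i=1}^{n}\max\{\|h(t_{i})-h(t_{i-1})\|_W-\delta,0\}.$$ For $p\ge1$, $\mathcal{U}^{p}([a,b],W)$ is the set of functions $h:[a,b]\to W$ with $\sup_{\delta>0}\delta^{p-1}\mathrm{TV}^{\delta}(h,[a,b])<+\infty$, and $\|h\|_{p\text{-TV},[a,b]}:=\left(\sup_{\delta>0}\delta^{p-1}\mathrm{TV}^{\delta}(h,[a,b])\right)^{1/p}$. Also $\|h\|_{\mathrm{osc},[a,b]}:=\sup_{a\le s<t\le b}\|h(s)-h(t)\|_{W}$. For $F:[a,t]\to L(E,V)$ and $g:[a,t]\to E$, the Riemann-Stieltjes integral $\int_a^t F\,\mathrm{d}g\in V$ is the common limit (if it exists) of the sums $\sum_{i}F(\xi_{i})[g(t_{i})-g(t_{i-1})]$ over all sequences of tagged partitions $a=t_0<t_1<\dots<t_n=t$, $\xi_i\in[t_{i-1},t_i]$, with mesh $\max_i(t_i-t_{i-1})$ tending to $0$ (and it is $0$ for $t=a$); here $F(\xi)[v]$ is the value of the linear map $F(\xi)$ at $v\in E$. *)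

(* Defs.v *)
From HB Require Import structures.
From mathcomp Require Import all_boot all_order all_algebra.
From mathcomp Require Import all_classical all_reals all_analysis.

Set Implicit Arguments.
Unset Strict Implicit.
Unset Printing Implicit Defensive.

Import Order.TTheory GRing.Theory Num.Theory.
Import numFieldNormedType.Exports.

Local Open Scope classical_set_scope.
Local Open Scope ring_scope.

(* L(E, V): the continuous linear maps from E to V, normed by the operator
   norm; a Banach space as soon as V is one. *)
Section clin.
Variables (R : realType) (E V : normedModType R).

Definition clinear : {pred E -> V} :=
  mem [set u : E -> V | linear u /\ continuous u].

Lemma clinear_submod_closed : submod_closed clinear.
Proof.
split=> [|a u v]; rewrite !inE /=.
  split; first by move=> a x y; rewrite /= scaler0 addr0.
  exact: cst_continuous.
move=> [lu cu] [lv cv]; split.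
  move=> c x y; rewrite !fctE lu lv !scalerDr !scalerA mulrC.
  by rewrite -!addrA; congr (_ + _); rewrite addrCA.
move=> x; apply: cvgD; last exact: cv.
by apply: cvgZl_tmp; exact: cu.
Qed.

HB.instance Definition _ :=
  GRing.isSubmodClosed.Build R (E -> V) clinear clinear_submod_closed.

Record clin := Clin { clin_fun :> E -> V ; clin_funP : clin_fun \in clinear }.

HB.instance Definition _ := [isSub for clin_fun].
HB.instance Definition _ := [Choice of clin by <:].
HB.instance Definition _ := [SubChoice_isSubLmodule of clin by <:].

Definition opnorm (u : clin) : R := sup [set `|u x| | x in [set x | `|x| <= 1]].

Lemma clin_linear (u : clin) : linear u.
Proof. by have := clin_funP u; rewrite inE => -[]. Qed.

Lemma clin_continuous (u : clin) : continuous u.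
Proof. by have := clin_funP u; rewrite inE => -[]. Qed.

HB.instance Definition _ (u : clin) :=
  GRing.isLinear.Build R E V *:%R u (clin_linear u).

Lemma clinDE (u v : clin) x : (u + v) x = u x + v x. Proof. by []. Qed.

Lemma clinNE (u : clin) x : (- u) x = - u x. Proof. by []. Qed.

Lemma clinZE a (u : clin) x : (a *: u) x = a *: u x. Proof. by []. Qed.

Lemma clin_bounded (u : clin) : exists M : R, forall x, `|x| <= 1 -> `|u x| <= M.
Proof.
have /bounded_funP/(_ 1) := (linear_bounded_continuous u).2 (@clin_continuous u).
exact.
Qed.

Lemma opnorm_has_sup (u : clin) :
  has_sup [set `|u x| | x in [set x | `|x| <= 1]].
Proof.
split; first by exists `|u 0|, 0 => //=; rewrite normr0.
by have [M uM] := clin_bounded u; exists M => _ [x x1 <-]; exact: uM.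
Qed.

Lemma opnorm_ub (u : clin) x : `|x| <= 1 -> `|u x| <= opnorm u.
Proof. by move=> x1; apply: ub_le_sup; [case: (opnorm_has_sup u)|exists x]. Qed.

Lemma opnorm_le (u : clin) M :
  (forall x, `|x| <= 1 -> `|u x| <= M) -> opnorm u <= M.
Proof.
move=> uM; apply: ge_sup; first by case: (opnorm_has_sup u).
by move=> _ [x x1 <-]; exact: uM.
Qed.

Lemma opnorm_ge0 u : 0 <= opnorm u.
Proof. by apply: le_trans (opnorm_ub u (x := 0) _); rewrite ?normr0. Qed.

Lemma opnormP (u : clin) x : `|u x| <= opnorm u * `|x|.
Proof.
have [->|x0] := eqVneq x 0; first by rewrite linear0 !normr0 mulr0.
have nx0 : 0 < `|x| by rewrite normr_gt0.
rewrite -ler_pdivrMr// mulrC -[X in X * _]gtr0_norm ?invr_gt0//.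
rewrite -normrZ -linearZ; apply: opnorm_ub.
by rewrite normrZ gtr0_norm ?invr_gt0// mulVf ?gt_eqF.
Qed.

Lemma opnormD u v : opnorm (u + v) <= opnorm u + opnorm v.
Proof.
apply: opnorm_le => x x1; rewrite clinDE (le_trans (ler_normD _ _))//.
by apply: lerD; exact: opnorm_ub.
Qed.

Lemma opnormZ a u : opnorm (a *: u) = `|a| * opnorm u.
Proof.
have le b w : opnorm (b *: w) <= `|b| * opnorm w.
  by apply: opnorm_le => x x1; rewrite clinZE normrZ ler_wpM2l// opnorm_ub.
apply/eqP; rewrite eq_le le/=.
have [->|a0] := eqVneq a 0; first by rewrite normr0 mul0r opnorm_ge0.
have := le a^-1 (a *: u); rewrite scalerA mulVf// scale1r normfV.
by rewrite mulrC ler_pdivlMr ?normr_gt0// mulrC.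
Qed.

Lemma opnorm0_eq0 u : opnorm u = 0 -> u = 0.
Proof.
move=> u0; apply/val_inj/funext => x /=; apply/eqP.
by rewrite -normr_le0 (le_trans (opnormP u x))// u0 mul0r.
Qed.

HB.instance Definition _ :=
  Lmodule_isNormed.Build R clin opnormD opnormZ opnorm0_eq0.

Lemma clin_normE (u : clin) : `|u| = opnorm u. Proof. by []. Qed.

End clin.

Section clin_complete.
Variables (R : realType) (E : normedModType R) (V : completeNormedModType R).

Let clin_cvg (F : set_system (clin E V)) : ProperFilter F -> cauchy F -> cvg F.
Proof.
move=> FF /cauchyP Fc.
have Fc' e : 0 < e -> exists u : clin E V, \forall v \near F, `|u - v| < e.
  by move=> /Fc[u]; rewrite -ball_normE; exists u.
have Fx x : cvg ((fun u : clin E V => u x) @ F).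
  apply/cauchy_cvgP/cauchyP => e e0.
  have d0 : 0 < e / (`|x| + 1) by rewrite divr_gt0// ltr_wpDl.
  have [u Fu] := Fc' _ d0; exists (u x); rewrite -ball_normE.
  rewrite /fmapE/=; apply: filterS Fu => v uv /=.
  rewrite -clinNE -clinDE (le_lt_trans (opnormP _ _))// -clin_normE.
  rewrite (@le_lt_trans _ _ (`|u - v| * (`|x| + 1)))//.
    by rewrite ler_wpM2l// lerDl.
  by rewrite -ltr_pdivlMr// ltr_wpDl.
pose L x := lim ((fun u : clin E V => u x) @ F).
have FL x : (fun u : clin E V => u x) @ F --> L x by exact: Fx.
have linL : linear L.
  move=> a x y.
  have h : (fun u : clin E V => a *: u x + u y) @ F --> a *: L x + L y.
    by apply: cvgD; [apply: cvgZl_tmp|]; exact: FL.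
  apply: cvg_lim => //; apply: cvg_trans h; apply: near_eq_cvg.
  by apply: nearW => u /=; rewrite linearP.
have dist (u : clin E V) (e : R) : 0 < e -> (\forall v \near F, `|u - v| < e) ->
    forall x, `|u x - L x| <= e * `|x|.
  move=> e0 Fu x; apply/ler_addgt0Pr => d d0.
  have /cvgrPdist_lt/(_ _ d0) Fd := FL x.
  near F => v.
  rewrite (le_trans (ler_distD (v x) _ _))// lerD//.
    rewrite -clinNE -clinDE (le_trans (opnormP _ _))// ler_wpM2r//.
    by apply/ltW; near: v.
  by rewrite distrC; apply/ltW; near: v.
pose LL : {linear E -> V} := HB.pack L (GRing.isLinear.Build _ _ _ _ _ linL).
have contL : continuous L.
  apply: (@bounded_linear_continuous R E V LL); apply/linear_boundedP.
  have [u /(dist u 1 ltr01) Fu] := Fc' 1 ltr01.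
  exists (opnorm u + 1); split=> [|r ur x]; first exact: num_real.
  rewrite (_ : LL x = u x - (u x - L x)); last by rewrite subKr.
  rewrite (le_trans (ler_normB _ _))// (@le_trans _ _ ((opnorm u + 1) * `|x|))//.
    by rewrite mulrDl lerD// opnormP.
  by rewrite ler_wpM2r// ltW.
have memL : L \in @clinear R E V by rewrite inE.
apply/cvg_ex; exists (Clin memL); apply/cvgrPdist_le => e e0.
have e20 : 0 < e / 2 by rewrite divr_gt0.
have [u Fu] := Fc' _ e20; have uL := dist _ _ e20 Fu.
apply: filterS Fu => v uv; apply: opnorm_le => x x1.
rewrite clinDE clinNE/= (le_trans (ler_distD (u x) _ _))//.
rewrite [e]splitr lerD//.
  by rewrite distrC (le_trans (uL x))// ler_piMr// ltW.
rewrite -clinNE -clinDE (le_trans (opnorm_ub _ x1))//.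
exact: ltW.
Unshelve. all: by end_near. Qed.

HB.instance Definition _ := Uniform_isComplete.Build (clin E V) clin_cvg.

End clin_complete.

Section p_variation.
Variables (R : realType) (W : normedModType R).
Implicit Types (h : R -> W) (a b p delta : R).

(* Functions on [a, b] are represented by functions on the whole of R of which
   only the values on [a, b] matter. *)

(* The points t_0 < ... < t_n are given as the head x and the tail s; the value
   n = 0 is allowed and only contributes an empty sum. *)
Definition truncated_variation delta h a b : \bar R :=
  ereal_sup [set v | exists x (s : seq R),
    [/\ a <= x, path <%R x s, last x s <= b &
     v = (\sum_(0 <= i < size s)
           Num.max (`|h (nth x s i) - h (nth x (x :: s) i)| - delta) 0)%:E]].

Definition sup_pTV p h a b : \bar R :=
  ereal_sup [set ((delta `^ (p - 1))%:E * truncated_variation delta h a b)%E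
            | delta in [set delta : R | 0 < delta]].

Definition Up p a b : set (R -> W) := [set h | (sup_pTV p h a b < +oo)%E].

Definition norm_pTV p h a b : \bar R := (sup_pTV p h a b `^ p^-1)%E.

Definition norm_osc h a b : \bar R :=
  ereal_sup [set v | exists s t : R,
    [/\ a <= s, s < t, t <= b & v = `|h s - h t|%:E]].

(* Discontinuity is relative to [a, b]: one-sided at the end points. *)
Definition discontinuities h a b : set R :=
  [set t | t \in `[a, b] /\ ~ (h x @[x --> within `[a, b] (nbhs t)] --> h t)].

End p_variation.

Section RiemannStieltjes.
Variables (R : realType) (E V : normedModType R).
Implicit Types (F : R -> clin E V) (g : R -> E) (a t : R).

(* P.1 = [:: t_1; ...; t_n] and P.2 = [:: xi_1; ...; xi_n], with t_0 = a, so
   that t_(i+1) and t_i are nth a P.1 i and nth a (a :: P.1) i. For t = a the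
   only partition is the empty one (n = 0), whence a zero integral. *)
Definition tagged_partition a t (P : seq R * seq R) :=
  [/\ itv_partition a t P.1, size P.2 = size P.1 &
   forall i, (i < size P.1)%N ->
     nth a (a :: P.1) i <= nth a P.2 i <= nth a P.1 i].

Definition mesh a (P : seq R * seq R) : R :=
  \big[Num.max/0]_(0 <= i < size P.1) (nth a P.1 i - nth a (a :: P.1) i).

Definition RS_sum F g a (P : seq R * seq R) : V :=
  \sum_(0 <= i < size P.1)
    F (nth a P.2 i) (g (nth a P.1 i) - g (nth a (a :: P.1) i)).

Definition is_RS_integral F g a t (v : V) :=
  forall P : nat -> seq R * seq R, (forall n, tagged_partition a t (P n)) ->
    mesh a (P n) @[n --> \oo] --> (0 : R) ->
    RS_sum F g a (P n) @[n --> \oo] --> v.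

(* Meaningful only when the integral exists. *)
Definition RS_integral F g a t : V := get (is_RS_integral F g a t).

End RiemannStieltjes.

(* Main.v *)
(* A bound A on d^(p-1) TV^d of f says that, along any sequence of points, at most
   A d^(-p) increments of f exceed 2d, and likewise for g with B and q. Hence, among
   m interior points of a partition, there is one whose removal changes a left
   Riemann-Stieltjes sum by at most
     min(osc f, 2 (3A/m)^(1/p)) * 2 (3B/m)^(1/q);
   this is summable in m because 1/p + 1/q > 1. Removing points down to a coarser
   partition x_0 < ... < x_n gives
     sum_i |int_(x_i)^(x_(i+1)) (f - f(x_i)) dg| <= K,
   with K a multiple of A^(1-1/q) (osc f)^(1+p/q-p) B^(1/q) that does not depend on
   the partition. The truncated variation of the integral then splits into that of
   (osc f) g and a sum of nonnegative terms of total at most K, each at most K.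
   The integral exists because, as f and g share no discontinuity, every product
   |f x - f y| |g u - g v| with nearby arguments is small; this makes the sum of the
   costs small as well. *)
Require Import Defs.
From HB Require Import structures.
From mathcomp Require Import all_boot all_order all_algebra.
From mathcomp Require Import all_classical all_reals all_analysis.
From mathcomp Require Import ring lra.

Set Implicit Arguments.
Unset Strict Implicit.
Unset Printing Implicit Defensive.

Import Order.TTheory GRing.Theory Num.Theory.
Import numFieldNormedType.Exports.

Local Open Scope classical_set_scope.
Local Open Scope ring_scope.

(** * Sums of powers of integers and of truncated powers *)

Section power_sums.
Variable R : realType.
Implicit Types (r s : R) (m n : nat).

(** Divided by (m + 1)^(1 - s), this reads 1 + (s - 1)/(m + 1) <= (1 - 1/(m + 1))^(1 - s), which
    follows from exp y >= 1 + y and ln(1 - x) <= - x. The bound telescopes. *)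
Lemma powR_opp_natS_le s m : 1 < s -> (0 < m)%N ->
  m.+1%:R `^ (- s) <= (s - 1)^-1 * (m%:R `^ (1 - s) - m.+1%:R `^ (1 - s)) :> R.
Proof.
move=> s1 m0; have s0 : 0 < s - 1 by rewrite subr_gt0.
have Mgt0 : 0 < m.+1%:R :> R by rewrite ltr0n.
have mgt0 : 0 < m%:R :> R by rewrite ltr0n.
rewrite mulrC ler_pdivlMr//.
have -> : m%:R `^ (1 - s) = m.+1%:R `^ (1 - s) * (m%:R / m.+1%:R) `^ (1 - s) :> R.
  by rewrite -powRM ?divr_ge0// mulrCA divff ?mulr1 // gt_eqF.
have -> : m.+1%:R `^ (- s) = m.+1%:R `^ (1 - s) * (m.+1%:R)^-1 :> R.
  rewrite -[X in _ = _ * X]powR_inv1 ?ltW// -powRD; last first.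
    by rewrite (gt_eqF Mgt0) implybT.
  by congr (_ `^ _); ring.
rewrite -[X in _ <= _ - X]mulr1 -mulrBr -mulrA ler_pM2l ?powR_gt0//.
rewrite lerBrDl /powR mulf_eq0 invr_eq0 (gt_eqF mgt0) (gt_eqF Mgt0)/=.
apply: le_trans (expR_ge1Dx _); rewrite lerD2l.
have : ln (1 + - m.+1%:R^-1) <= - m.+1%:R^-1 :> R.
  by apply: le_ln1Dx; rewrite ltrN2 invf_lt1 // ltr1n ltnS.
rewrite [1 + _](_ : _ = m%:R / m.+1%:R); last first.
  by rewrite -[m.+1%:R]natr1; field; rewrite natr1 gt_eqF.
by move=> h; have := ler_wpM2l (ltW s0) h; rewrite mulrN; set L := ln _; set x := m.+1%:R^-1; lra.
Qed.

(** With x = 1/(m + 1) and y = r x the claim is (1 - x)^r <= 1 - y/2. It holds because (1 - x)^r <=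
    exp(- y) <= 1/(1 + y), and 1/(1 + y) <= 1 - y/2 for 0 <= y <= 1. *)
Lemma powR_natS_sub_ge r m : 0 < r -> r < 1 ->
  m.+1%:R `^ (r - 1) <= (2 / r) * (m.+1%:R `^ r - m%:R `^ r) :> R.
Proof.
move=> r0 r1; have Mgt0 : 0 < m.+1%:R :> R by rewrite ltr0n.
rewrite -ler_pdivrMl ?divr_gt0// invf_div.
have -> : m%:R `^ r = m.+1%:R `^ r * (m%:R / m.+1%:R) `^ r :> R.
  by rewrite -powRM ?divr_ge0// mulrCA divff ?mulr1 // gt_eqF.
have -> : m.+1%:R `^ (r - 1) = m.+1%:R `^ r * (m.+1%:R)^-1 :> R.
  rewrite -[X in _ = _ * X]powR_inv1 ?ltW// -powRD//.
  by rewrite (gt_eqF Mgt0) implybT.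
rewrite -[X in _ <= X - _]mulr1 -mulrBr mulrCA ler_pM2l ?powR_gt0//.
have M1 : m.+1%:R^-1 <= 1 :> R by rewrite invf_le1 // ler1n.
have iM0 : 0 < m.+1%:R^-1 :> R by rewrite invr_gt0.
(* For m = 0 the logarithm below would be taken at 0; there the claim is just r/2 <= 1. *)
case: m Mgt0 M1 iM0 => [|m] Mgt0 M1 iM0.
  by rewrite mul0r powR0 ?gt_eqF//; nra.
set x : R := m.+2%:R^-1 in M1 iM0 *.
have E : m.+1%:R / m.+2%:R = 1 - x.
  rewrite (_ : m.+1%:R = m.+2%:R - 1); last by rewrite -[m.+2%:R]natr1 addrK.
  by rewrite mulrBl divff ?gt_eqF// mul1r.
have x1 : x < 1 by rewrite invf_lt1 // ltr1n.
have hpos : 0 < m.+1%:R / m.+2%:R :> R by rewrite divr_gt0.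
suff : (m.+1%:R / m.+2%:R) `^ r * (1 + r * x) <= 1.
  have rx0 : 0 < r * x by rewrite mulr_gt0.
  have rx1 : r * x <= 1 by rewrite mulr_ile1 ?ltW.
  rewrite mulrAC; move: (_ `^ r) (r * x) rx0 rx1 => W y y0 y1 h.
  by have [hW|hW] := lerP W 2^-1; nra.
rewrite /powR gt_eqF// E.
apply: (@le_trans _ _ (expR (r * ln (1 - x)) * expR (r * x))).
  by rewrite ler_pM2l ?expR_gt0// expR_ge1Dx.
rewrite -expRD expR_le1 -mulrDr pmulr_rle0//.
by have := @le_ln1Dx R (- x); rewrite ltrN2 => /(_ x1); lra.
Qed.

Lemma sum_powR_sub1_le r n : 0 < r -> r < 1 ->
  \sum_(1 <= m < n.+1) m%:R `^ (r - 1) <= (2 / r) * n%:R `^ r :> R.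
Proof.
move=> r0 r1; elim: n => [|n IH]; first by rewrite big_geq// powR0 ?gt_eqF// mulr0.
rewrite big_nat_recr//=; have := powR_natS_sub_ge n r0 r1.
rewrite mulrBr; lra.
Qed.

Lemma sum_powR_opp_le s n k : 1 < s -> (0 < n)%N ->
  \sum_(n.+1 <= m < k) m%:R `^ (- s) <= (s - 1)^-1 * n%:R `^ (1 - s) :> R.
Proof.
move=> s1 n0; have s0 : 0 <= (s - 1)^-1 by rewrite invr_ge0 subr_ge0 ltW.
case: (leqP k n.+1) => [kn|]; first by rewrite big_geq// mulr_ge0// powR_ge0.
move=> /ltnW nk; rewrite -(subnKC nk); move: (k - n.+1)%N => {nk}k.
suff : \sum_(n.+1 <= m < n.+1 + k) m%:R `^ (- s) <=
    (s - 1)^-1 * (n%:R `^ (1 - s) - (n + k)%:R `^ (1 - s)) :> R.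
  move/le_trans; apply; rewrite ler_wpM2l// gerBl powR_ge0//.
elim: k => [|k IH]; first by rewrite !addn0 big_geq// subrr mulr0.
rewrite addnS big_nat_recr/=; last by rewrite leq_addr.
have := @powR_opp_natS_le s (n + k) s1; rewrite addn_gt0 n0/= => /(_ isT).
rewrite !addSn !addnS in IH *; lra.
Qed.

(* The minimum switches between its two arguments at m = nu; below and above nu
   the two sums are both of order nu ^ (1 - 1/q). *)
Lemma sum_min_powR_le (p q : R) : 1 < p -> 1 < q -> 1 < p^-1 + q^-1 ->
  exists2 C : R, 0 < C & forall (nu : R) (n : nat), 2 `^ (- p) <= nu ->
    \sum_(1 <= m < n) Num.min 1 ((nu / m%:R) `^ p^-1) * m%:R `^ (- q^-1)
      <= C * nu `^ (1 - q^-1).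
Proof.
move=> p1 q1 pq; have p0 : 0 < p by lra.
have q0 : 0 < q by lra.
have iq0 : 0 < q^-1 by rewrite invr_gt0.
have iq1 : q^-1 < 1 by rewrite invf_lt1.
have r0 : 0 < 1 - q^-1 by lra.
have r1 : 1 - q^-1 < 1 by lra.
have twop : 0 < 2 `^ p :> R by rewrite powR_gt0.
pose s := p^-1 + q^-1.
(* [C1] covers the range m <= N, where N is the integer just above [nu]: since 1 <= nu 2^p, N is at
   most (1 + 2^p) nu. The range m > N gives 1/(s - 1). *)
pose C1 := (2 / (1 - q^-1)) * (1 + 2 `^ p) `^ (1 - q^-1).
have C10 : 0 < C1 by rewrite mulr_gt0 ?divr_gt0// powR_gt0// addr_gt0.
have C20 : 0 < (s - 1)^-1 by rewrite invr_gt0 subr_gt0.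
exists (C1 + (s - 1)^-1); first by rewrite addr_gt0.
move=> nu n nu_ge; have nu0 : 0 < nu by rewrite (lt_le_trans _ nu_ge)// powR_gt0.
have nu1 : 1 <= nu * 2 `^ p.
  by rewrite -ler_pdivrMr// div1r -powRN.
pose N := (Num.truncn nu).+1.
have nuN : nu <= N%:R by rewrite ltW// truncnS_gt.
have Nnu : N%:R <= nu * (1 + 2 `^ p).
  rewrite mulrDr mulr1 [N%:R](_ : _ = (Num.truncn nu)%:R + 1); last by rewrite natr1.
  rewrite lerD//.
  by have := truncn_itv (ltW nu0) => /andP[].
have N0 : 0 < N%:R :> R by rewrite ltr0n.
pose e (m : nat) : R := Num.min 1 ((nu / m%:R) `^ p^-1) * m%:R `^ (- q^-1).
have e0 m : 0 <= e m.
  by rewrite mulr_ge0 ?powR_ge0// le_min ler01 powR_ge0.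
apply: (@le_trans _ _ (\sum_(1 <= m < N.+1) e m + \sum_(N.+1 <= m < maxn n N.+1) e m)).
  rewrite -big_cat_nat//=; last by rewrite leq_maxr.
  case: (leqP 1 n) => n1; last first.
    by rewrite [X in X <= _]big_geq ?(ltnW n1)// sumr_ge0.
  rewrite (@big_cat_nat _ _ _ n 1 (maxn n N.+1))//= ?leq_maxl//.
  by rewrite lerDl sumr_ge0.
rewrite mulrDl; apply: lerD.
  apply: (@le_trans _ _ (\sum_(1 <= m < N.+1) m%:R `^ (1 - q^-1 - 1))).
    apply: ler_sum_nat => m _; rewrite /e.
    rewrite (_ : 1 - q^-1 - 1 = - q^-1); last by ring.
    by rewrite ler_piMl ?powR_ge0// ge_min lexx.
  apply: (le_trans (sum_powR_sub1_le N r0 r1)).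
  rewrite /C1 -[X in _ <= X]mulrA ler_pM2l ?divr_gt0//.
  have hp : 0 <= 1 + 2 `^ p :> R by rewrite addr_ge0 ?ltW.
  rewrite -powRM ?(ltW nu0)//.
  by rewrite ge0_ler_powR ?nnegrE ?(ltW r0) ?mulr_ge0 ?(ltW nu0)// mulrC.
apply: (@le_trans _ _ (\sum_(N.+1 <= m < maxn n N.+1) nu `^ p^-1 * m%:R `^ (- s))).
  apply: ler_sum_nat => m /andP[Nm _]; rewrite /e.
  have m0 : 0 < m%:R :> R by rewrite ltr0n (leq_trans _ Nm).
  rewrite /s opprD powRD; last by rewrite (gt_eqF m0) implybT.
  rewrite mulrA ler_wpM2r ?powR_ge0//.
  rewrite powRM ?invr_ge0 ?(ltW nu0) ?(ltW m0)// -[m%:R^-1]powR_inv1 ?(ltW m0)// -powRrM mulN1r.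
  by rewrite ge_min lexx orbT.
rewrite -mulr_sumr.
apply: le_trans (ler_wpM2l (powR_ge0 _ _) (sum_powR_opp_le _ pq _)) _ => //.
rewrite mulrCA ler_pM2l//.
rewrite [X in _ <= X](_ : _ = nu `^ p^-1 * nu `^ (1 - s)); last first.
  rewrite -powRD; last by rewrite (gt_eqF nu0) implybT.
  by congr (_ `^ _); rewrite /s; ring.
rewrite ler_pM2l ?powR_gt0//.
rewrite -[1 - s]opprB !powRN lef_pV2 ?posrE ?powR_gt0//.
by rewrite ge0_ler_powR ?nnegrE ?(ltW nu0) ?(ltW N0) ?subr_ge0 ?(ltW pq).
Qed.

(** For 0 < l < 1, min(c, x) <= c^(1 - l) x^l. Choosing l with s l still above 1 keeps the series
    convergent and leaves a factor c^(1 - l), which is small with c. *)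
Lemma sum_min_powR_small (s K eps : R) : 1 < s -> 0 < K -> 0 < eps ->
  exists2 c : R, 0 < c &
    forall n, \sum_(1 <= m < n) Num.min c (K * m%:R `^ (- s)) <= eps.
Proof.
move=> s1 K0 eps0.
pose t := (s + 1) / 2; have t1 : 1 < t by rewrite /t; lra.
pose l := t / s; have s0 : 0 < s by lra.
have l0 : 0 < l by rewrite divr_gt0//; lra.
have l1 : l < 1 by rewrite ltr_pdivrMr// mul1r /t; lra.
have C0 : 0 < (1 + (t - 1)^-1) by rewrite addr_gt0// invr_gt0 subr_gt0.
pose C := K `^ l * (1 + (t - 1)^-1).
have Cgt0 : 0 < C by rewrite mulr_gt0 ?powR_gt0.
exists ((eps / C) `^ (1 - l)^-1); first by rewrite powR_gt0 ?divr_gt0.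
set c := _ `^ _; have c0 : 0 < c by rewrite powR_gt0 ?divr_gt0.
have cE : c `^ (1 - l) = eps / C.
  by rewrite /c -powRrM mulVf ?powRr1 ?divr_ge0 ?ltW// gt_eqF// subr_gt0.
have min_le (x : R) : 0 <= x -> Num.min c x <= c `^ (1 - l) * x `^ l.
  move=> x0; case: (leP c x) => cx.
    rewrite -[X in X <= _](powRr1 (ltW c0)) -{1}(subrK l 1) powRD; last first.
      by rewrite (gt_eqF c0) implybT.
    by rewrite ler_wpM2l ?powR_ge0// (ge0_ler_powR (ltW l0)) ?nnegrE// ltW.
  move: x0; rewrite le_eqVlt => /predU1P[<-|x0]; first by rewrite powR0 ?gt_eqF// mulr0.
  rewrite -[X in X <= _](powRr1 (ltW x0)) -{1}(subrK l 1) powRD; last first.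
    by rewrite (gt_eqF x0) implybT.
  by rewrite ler_wpM2r ?powR_ge0// ge0_ler_powR ?nnegrE ?subr_ge0 ?(ltW l1) ?(ltW cx) ?(ltW c0) ?(ltW x0).
move=> n; apply: (@le_trans _ _ (\sum_(1 <= m < n) c `^ (1 - l) * K `^ l * m%:R `^ (- t))).
  apply: ler_sum_nat => m _.
  apply: le_trans (min_le _ _) _; first by rewrite mulr_ge0 ?powR_ge0// ltW.
  rewrite -mulrA ler_wpM2l ?powR_ge0// powRM ?powR_ge0 ?(ltW K0)//.
  by rewrite -powRrM mulNr (_ : s * l = t)// /l mulrC divfK// gt_eqF.
rewrite -mulr_sumr cE.
have : \sum_(1 <= m < n) m%:R `^ (- t) <= 1 + (t - 1)^-1.
  case: n => [|[|n]]; [by rewrite big_geq// ltW|by rewrite big_geq// ltW|].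
  rewrite big_nat_recl//= powR1 lerD2l.
  have := @sum_powR_opp_le t 1 n.+2 t1 isT; rewrite powR1 mulr1 => h; rewrite big_add1 in h; exact: h.
move=> h; apply: (@le_trans _ _ (eps / C * K `^ l * (1 + (t - 1)^-1))).
  by rewrite ler_pM2l// mulr_gt0 ?divr_gt0 ?powR_gt0.
by rewrite -mulrA -/C divfK// gt_eqF.
Qed.

End power_sums.

(** * Weak summability and sums of products *)

Section weak_sums.
Variable R : realType.
Implicit Types (p q A B c d : R).

(** This is what a bound [A] on d^(p-1) TV^d says about the increments [u] along one sequence of
    points. The summands are nonnegative, so it passes to subsequences. *)
Definition weak_sum (T : Type) p A (u : T -> R) (s : seq T) :=
  forall d, 0 < d -> \sum_(x <- s) Num.max (u x - d) 0 <= A * d `^ (1 - p).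

Lemma weak_sum_filter (T : Type) p A (u : T -> R) (P : pred T) s :
  weak_sum p A u s -> weak_sum p A u (seq.filter P s).
Proof.
move=> us d d0; apply: le_trans (us d d0); rewrite big_filter.
rewrite [X in _ <= X](bigID P)/= lerDl sumr_ge0// => x _.
by rewrite le_max lexx orbT.
Qed.

Lemma weak_sum_map (T T' : Type) p A (u : T -> R) (h : T' -> T) s :
  weak_sum p A u (map h s) -> weak_sum p A (u \o h) s.
Proof. by move=> us d /us; rewrite big_map. Qed.

Lemma weak_sum_cons (T : Type) p A (u : T -> R) x s :
  weak_sum p A u (x :: s) -> weak_sum p A u s.
Proof.
move=> us d d0; apply: le_trans (us d d0).
by rewrite big_cons lerDr le_max lexx orbT.
Qed.

Lemma weak_sum_perm (T : eqType) p A (u : T -> R) s s' :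
  perm_eq s s' -> weak_sum p A u s -> weak_sum p A u s'.
Proof. by move=> ss' us d /us; rewrite (perm_big _ ss'). Qed.

(** Every entry with [u x] above 2d contributes more than d to the sum. *)
Lemma weak_sum_count (T : Type) p A (u : T -> R) s d : 0 < d ->
  weak_sum p A u s -> (count (fun x => 2 * d < u x) s)%:R <= A * d `^ (- p).
Proof.
move=> d0 us; rewrite -(ler_pM2r d0).
have <- : A * d `^ (1 - p) = A * d `^ (- p) * d.
  rewrite -mulrA -{3}(powRr1 (ltW d0)) -powRD ?(gt_eqF d0) ?implybT//.
  by rewrite [- p + 1]addrC.
apply: le_trans (us d d0).
elim: s {us} => [|x s IH]; first by rewrite big_nil mul0r.
rewrite big_cons/= natrD mulrDl lerD//.
case: ltP => h; rewrite ?mul1r ?mul0r le_max ?lexx ?orbT//.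
by apply/orP; left; lra.
Qed.

(* Twice the level exceeded by at most m/3 of the u x, see weak_sum_count. *)
Definition weak_rate p A (m : nat) : R := 2 * (3 * A / m%:R) `^ p^-1.

Lemma weak_rate_ge0 p A m : 0 <= weak_rate p A m.
Proof. by rewrite mulr_ge0// powR_ge0. Qed.

(** Each of [u] and [v] exceeds its weak rate at no more than a third of the entries, so some entry
    stays below both rates. *)
Lemma weak_sum_small (T : eqType) p q A B (u v : T -> R) s :
  0 < p -> 0 < q -> 0 < A -> 0 < B ->
  weak_sum p A u s -> weak_sum q B v s -> (0 < size s)%N ->
  exists2 x, x \in s &
    u x <= weak_rate p A (size s) /\ v x <= weak_rate q B (size s).
Proof.
move=> p0 q0 A0 B0 us vs s0.
have m0 : 0 < (size s)%:R :> R by rewrite ltr0n.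
have third r D w : 0 < r -> 0 < D -> weak_sum r D w s ->
    (count (fun x => weak_rate r D (size s) < w x) s)%:R <= (size s)%:R / 3 :> R.
  move=> r0 D0 ws; have b0 : 0 < 3 * D / (size s)%:R by rewrite divr_gt0 ?mulr_gt0.
  have := weak_sum_count (powR_gt0 r^-1 b0) ws.
  rewrite -powRrM mulrN mulVf ?gt_eqF// powR_inv1 ?(ltW b0)//.
  move/le_trans; apply; rewrite le_eqVlt; apply/orP; left; apply/eqP.
  by field; rewrite !gt_eqF.
have := third _ _ _ p0 A0 us; have := third _ _ _ q0 B0 vs.
set P := (fun x => _); set Q := (fun x => _ < u x) => cP cQ.
have [/hasP[x xs]|/hasPn h] := boolP (has (predC (predU P Q)) s).
  by rewrite /= /P /Q negb_or -!leNgt => /andP[]; exists x.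
suff : (size s <= count P s + count Q s)%N.
  by rewrite -(ler_nat R) natrD; lra.
rewrite -[X in (X <= _)%N](_ : count (predU P Q) s = _); last first.
  by apply/eqP; rewrite -all_count; apply/allP => x /h /negPn.
by rewrite -count_predUI leq_addr.
Qed.

(** Greedy summation: an entry small for both [u] and [v] is taken out, its product being at most
    the term of index [size s], and the argument is repeated with one entry less. *)
Lemma sum_mul_weak_le (T : eqType) p q A B c (u v : T -> R) s :
  0 < p -> 0 < q -> 0 < A -> 0 < B ->
  (forall x, 0 <= u x) -> (forall x, 0 <= v x) ->
  (forall x, x \in s -> u x * v x <= c) ->
  weak_sum p A u s -> weak_sum q B v s ->
  \sum_(x <- s) u x * v x <=
    \sum_(1 <= m < (size s).+1) Num.min c (weak_rate p A m * weak_rate q B m).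
Proof.
move=> p0 q0 A0 B0 u0 v0; have [n] := ubnP (size s); elim: n s => // n IH s sn uvc us vs.
case: (posnP (size s)) => [/size0nil ->|s0]; first by rewrite big_nil big_geq.
have [x xs [ux vx]] := weak_sum_small p0 q0 A0 B0 us vs s0.
have ps := perm_to_rem xs.
rewrite (perm_big _ ps) big_cons/= addrC big_nat_recr//= lerD//.
  have -> : size s = (size (rem x s)).+1 by rewrite (perm_size ps).
  apply: IH => [|y /mem_rem ys||].
  - by move: sn; rewrite (perm_size ps).
  - exact: uvc.
  - exact: weak_sum_cons (weak_sum_perm ps us).
  - exact: weak_sum_cons (weak_sum_perm ps vs).
by rewrite le_min uvc//= ler_pM.
Qed.

End weak_sums.

(** * Removing points from a list one at a time *)

Section removal.
Variables (R : realType).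

(** Each point comes with both neighbours, [y] closing the list, so that the increment of f on its
    left and that of g on its right are indexed by the same point. *)
Fixpoint triples (x : R) s y : seq (R * R * R) :=
  if s is w :: s' then (x, w, head y s') :: triples w s' y else [::].

Lemma triples_split x s y l w r : (l, w, r) \in triples x s y ->
  exists s1 s2, [/\ s = s1 ++ w :: s2, l = last x s1 & r = head y s2].
Proof.
elim: s x => //= v s IH x; rewrite inE => /predU1P[[-> -> ->]|/IH].
  by exists [::], s.
by move=> [s1 [s2 [-> -> ->]]]; exists (v :: s1), s2.
Qed.

Lemma triples_left x s y : [seq (t.1.1, t.1.2) | t <- triples x s y] = zip (x :: s) s.
Proof. by elim: s x => //= v s IH x; rewrite IH. Qed.

Lemma triples_right x s y :
  [seq (t.1.2, t.2) | t <- triples x s y] = zip s (behead (rcons s y)).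
Proof.
case: s => //= w s; elim: s x w => [|v s IH] x w //=.
by congr cons; rewrite -(IH w v).
Qed.

Lemma size_triples (P : pred R) x s y :
  size [seq t <- triples x s y | P t.1.2] = count P s.
Proof. by elim: s x => //= v s IH x; case: (P v) => /=; rewrite IH. Qed.

(** Paths for [<=] allow repeated points, which occur when a tag coincides with a partition
    point. *)
Definition tv_bound (W : normedModType R) p A (h : R -> W) a b :=
  forall x s, a <= x -> path <=%R x s -> last x s <= b ->
    weak_sum p A (fun w => `|h w.2 - h w.1|) (zip (x :: s) s).

Lemma path_ltW (x : R) s : path <%R x s -> path <=%R x s.
Proof. by apply: sub_path => ? ? /ltW. Qed.

(* Of the m unprotected points, some w has both its f-increment to the left and
   its g-increment to the right below the respective weak rate at m; removing w
   costs at most their product, and then m drops by one. *)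
Lemma removal_le (W1 W2 : normedModType R) (p q A B o c a b x y : R)
    (f : R -> W1) (g : R -> W2) (P : pred R) (Phi : seq R -> R) s :
  0 < p -> 0 < q -> 0 < A -> 0 < B ->
  tv_bound p A f a b -> tv_bound q B g a b ->
  a <= x -> y <= b -> path <%R x (rcons s y) ->
  (forall u w, a <= u -> u <= w -> w <= b -> `|f w - f u| <= o) ->
  (forall u w v, x <= u -> u < w -> w < v -> v <= y ->
     (forall z, z \in s -> P z -> z <= u \/ v <= z) ->
     `|f w - f u| * `|g v - g w| <= c) ->
  (forall s1 w s2, ~~ P w -> Phi (s1 ++ w :: s2) <=
     Phi (s1 ++ s2) + `|f w - f (last x s1)| * `|g (head y s2) - g w|) ->
  Phi s <= Phi (seq.filter P s) + \sum_(1 <= m < (count (predC P) s).+1)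
     Num.min c (Num.min o (weak_rate p A m) * weak_rate q B m).
Proof.
move=> p0 q0 A0 B0 tvf tvg ax yb xsy Ho Hc HPhi.
have [n] := ubnP (count (predC P) s); elim: n s xsy Hc => // n IH s xsy Hc sn.
case: (posnP (count (predC P) s)) => [s0|s0].
  rewrite s0 big_geq// addr0 (_ : seq.filter P s = s)//; apply/all_filterP.
  rewrite all_count -(count_predC P s) s0 addn0//.
pose t := [seq t <- triples x s y | predC P t.1.2].
have szt : size t = count (predC P) s by rewrite size_triples.
have ys : last x (rcons s y) = y by rewrite last_rcons.
have tf : weak_sum p A (fun t => `|f t.1.2 - f t.1.1|) t.
  apply: weak_sum_filter.
  apply: (@weak_sum_map _ _ _ _ _ (fun w => `|f w.2 - f w.1|) (fun t => (t.1.1, t.1.2))).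
  rewrite triples_left; apply: tvf => //.
    by move: xsy; rewrite rcons_path => /andP[/path_ltW].
  by move: xsy; rewrite rcons_path => /andP[_ /ltW /le_trans]; apply.
have tg : weak_sum q B (fun t => `|g t.2 - g t.1.2|) t.
  apply: weak_sum_filter.
  apply: (@weak_sum_map _ _ _ _ _ (fun w => `|g w.2 - g w.1|) (fun t => (t.1.2, t.2))).
  rewrite triples_right; case: (s) xsy ys => [|w s'] /= h ys.
    by move=> d d0; rewrite big_nil mulr_ge0 ?powR_ge0 ?ltW.
  have -> : zip (w :: s') (rcons s' y) = zip (w :: rcons s' y) (rcons s' y).
    by elim: (s') (w) => //= v r E v'; rewrite E.
  case/andP: h => xw ws; apply: tvg; last by rewrite ys.
    by rewrite (le_trans ax)// ltW.
  exact: path_ltW.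
have [] := weak_sum_small p0 q0 A0 B0 tf tg _; first by rewrite szt.
move=> [[l w] r]; rewrite mem_filter/= => /andP[Pw /triples_split[s1 [s2 [sE lE rE]]]].
rewrite szt => -[fw gw].
have cE : count (predC P) s = (count (predC P) (s1 ++ s2)).+1.
  by rewrite sE !count_cat/= Pw addnCA.
have path1 : path <%R x (s1 ++ w :: rcons s2 y).
  by rewrite sE rcons_cat rcons_cons in xsy.
have [lw wr] : l < w /\ w < r.
  move: path1; rewrite cat_path/= lE rE => /and3P[_ -> ].
  by case: (s2) => [|? ?] /= /andP[].
have srt : sorted <%R (x :: s1 ++ w :: rcons s2 y) by exact: path1.
have xl : x <= l.
  rewrite lE; move: path1; rewrite cat_path => /andP[].
  case/lastP: (s1) => // s1' z; rewrite last_rcons => h _; apply: ltW.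
  by move: h; rewrite lt_path_sortedE => /andP[/allP + _]; apply; rewrite mem_rcons mem_head.
have pathr : path <%R w (rcons s2 y).
  by move: path1; rewrite cat_path => /and3P[].
have ry : r <= y.
  rewrite rE; case: (s2) pathr => //= z s2' /andP[_].
  rewrite lt_path_sortedE => /andP[/allP + _] => h; apply/ltW/h.
  by rewrite mem_rcons mem_head.
apply: le_trans (_ : Phi (s1 ++ s2) + `|f w - f l| * `|g r - g w| <= _).
  by rewrite sE lE rE HPhi.
(* The cost of [w] is absorbed by the last term, whose index is the number of unprotected points
   before the removal; the other terms are left for the shortened list. *)
rewrite cE big_nat_recr//= addrA lerD//; last first.
  rewrite le_min; apply/andP; split.
    (* No protected point lies strictly between the neighbours [l] and [r] of [w]. *)
    apply: Hc => // z; rewrite sE mem_cat inE => /or3P[zs1|/eqP ->|zs2] Pz.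
    - left; rewrite lE; move: path1; rewrite cat_path => /andP[h _].
      case/splitPr: zs1 h => z1 z2; rewrite cat_path/= last_cat/= => /and3P[_ _].
      case/lastP: z2 => // z2 z3; rewrite last_rcons lt_path_sortedE => /andP[/allP h _].
      by apply/ltW/h; rewrite mem_rcons mem_head.
    - by rewrite Pz in Pw.
    - right; rewrite rE; move: pathr; case: (s2) zs2 => //= v r'.
      rewrite inE => /predU1P[->//|zr] /andP[_].
      rewrite lt_path_sortedE => /andP[/allP h _].
      by apply/ltW/h; rewrite mem_rcons inE zr orbT.
  rewrite -cE ler_pM// le_min fw andbT Ho ?(ltW lw)// ?(le_trans ax)//.
  by rewrite (le_trans _ yb)// (le_trans _ ry)// ltW.
have -> : seq.filter P s = seq.filter P (s1 ++ s2).
  by rewrite sE !filter_cat/= (negbTE Pw).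
apply: IH.
- have : path <%R x (s1 ++ rcons s2 y).
    move: path1; rewrite !cat_path -lE /= => /and3P[-> _].
    case: (s2) => [|? ?]/= /andP[h h']; rewrite ?h' (lt_trans lw)//.
  by rewrite rcons_cat.
- move=> u v z xu uv vz zy h; apply: Hc => // z' z's Pz'; apply: h => //.
  move: z's; rewrite sE !mem_cat inE => /or3P[->//|/eqP z'E|->]; last by rewrite orbT.
  by rewrite -z'E Pz' in Pw.
- by move: sn; rewrite cE.
Qed.

End removal.

(** * From the truncated variation to weak bounds *)

Section truncated_variation_bounds.
Variables (R : realType) (W : normedModType R).
Implicit Types (h : R -> W) (a b x y p A : R).

Lemma big_zip_nth (T : Type) (op : T -> T -> T) (idx : T) (F : R -> R -> T) d x
    (s : seq R) :
  \big[op/idx]_(0 <= i < size s) F (nth d (x :: s) i) (nth d s i) =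
  \big[op/idx]_(w <- zip (x :: s) s) F w.1 w.2.
Proof.
elim: s x => [|y s IH] x; first by rewrite big_geq//= big_nil.
by rewrite big_ltn// big_add1 /= big_cons -IH.
Qed.

Lemma path_le_lt (G : R -> R -> R) x s : (forall x, G x x = 0) ->
  path <=%R x s -> exists s', [/\ path <%R x s', last x s' = last x s &
    \sum_(w <- zip (x :: s') s') G w.1 w.2 = \sum_(w <- zip (x :: s) s) G w.1 w.2].
Proof.
move=> G0; elim: s x => [|y s IH] x /=; first by exists [::]; rewrite big_nil.
case/andP; rewrite le_eqVlt big_cons => /predU1P[<-|xy] /IH[s' [ps' ls' E]].
  by exists s'; rewrite G0 add0r.
by exists (y :: s'); rewrite /= xy ps' big_cons E.
Qed.

Lemma Up_tv_bound p h a b : Up p a b h ->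
  tv_bound p (fine (sup_pTV p h a b)) h a b.
Proof.
move=> hp x s ax xs sb d d0.
pose G u v := Num.max (`|h v - h u| - d) 0.
have G0 u : G u u = 0.
  by rewrite /G subrr normr0 sub0r; apply/max_idPr; rewrite oppr_le0 ltW.
have [s' [xs' s's E]] := path_le_lt G0 xs.
rewrite /= in E *; rewrite -E; set S := \sum_(_ <- _) _.
have hS : (S%:E <= truncated_variation d h a b)%E.
  apply: ereal_sup_ubound; exists x, s'; split => //; first by rewrite s's.
  by rewrite (big_zip_nth _ _ G).
have h2 : ((d `^ (p - 1))%:E * S%:E <= sup_pTV p h a b)%E.
  apply: le_trans (_ : ((d `^ (p - 1))%:E * truncated_variation d h a b <= _)%E).
    by rewrite lee_wpmul2l// lee_fin powR_ge0.
  by apply: ereal_sup_ubound; exists d.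
have fin : sup_pTV p h a b \is a fin_num.
  rewrite fin_numE (lt_eqF hp) andbT; apply/negP => /eqP E2.
  by move: h2; rewrite E2 -EFinM leNgt ltNyr.
rewrite -[1 - p]opprB powRN ler_pdivlMr ?powR_gt0//.
by rewrite -lee_fin fineK// mulrC EFinM.
Qed.

(** Truncating at half of the increment w gives w/2 <= A (w/2)^(1 - p), that is (w/2)^p <= A. *)
Lemma tv_bound_osc p A h a b u v : 0 < p -> tv_bound p A h a b ->
  a <= u -> u <= v -> v <= b -> `|h v - h u| <= 2 * A `^ p^-1.
Proof.
move=> p0 tv au uv vb.
have := normr_ge0 (h v - h u); rewrite le_eqVlt => /predU1P[<-|w0].
  by rewrite mulr_ge0// powR_ge0.
set w := `|_| in w0 *; have d0 : 0 < w / 2 by rewrite divr_gt0.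
have := tv u [:: v] au; rewrite /= uv => /(_ isT vb _ d0).
rewrite big_seq1 /= -/w => /(le_trans _) hA.
have {}hA : w / 2 <= A * (w / 2) `^ (1 - p) by apply: hA; rewrite le_max; apply/orP; left; lra.
have hp : (w / 2) `^ p <= A.
  move: hA; rewrite -[1 - p]opprB powRN ler_pdivlMr ?powR_gt0//.
  by rewrite mulr_powRB1 ?(ltW d0).
have : ((w / 2) `^ p) `^ p^-1 <= A `^ p^-1.
  by rewrite ge0_ler_powR ?invr_ge0 ?nnegrE ?powR_ge0 ?(ltW p0)// (le_trans _ hp)// powR_ge0.
by rewrite -powRrM mulfV ?gt_eqF// powRr1 ?(ltW d0)//; lra.
Qed.

Lemma tv_boundW p A A' h a b : A <= A' -> tv_bound p A h a b -> tv_bound p A' h a b.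
Proof.
move=> AA' tv x s ax xs sb d d0; apply: le_trans (tv x s ax xs sb d d0) _.
by rewrite ler_wpM2r// powR_ge0.
Qed.

End truncated_variation_bounds.

(** * Left Riemann-Stieltjes sums *)

Section left_sums.
Variables (R : realType) (E V : normedModType R).
Variables (F : R -> clin E V) (g : R -> E).
Implicit Types (x y : R) (s : seq R).

Lemma clin_norm_le (u : clin E V) z : `|u z| <= `|u| * `|z|.
Proof. by rewrite clin_normE opnormP. Qed.

Lemma clinD (u : clin E V) z1 z2 : u (z1 + z2) = u z1 + u z2.
Proof. exact: raddfD. Qed.

Lemma clin_subE (u v : clin E V) z : (u - v) z = u z - v z. Proof. by []. Qed.

Definition lsum x s : V := \sum_(w <- zip (x :: s) s) F w.1 (g w.2 - g w.1).

Lemma lsum_cons x y s : lsum x (y :: s) = F x (g y - g x) + lsum y s.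
Proof. by rewrite /lsum /= big_cons. Qed.

Lemma lsum_cat x s1 s2 : lsum x (s1 ++ s2) = lsum x s1 + lsum (last x s1) s2.
Proof.
elim: s1 x => [|y s1 IH] x /=; first by rewrite {2}/lsum /= big_nil add0r.
by rewrite !lsum_cons IH addrA.
Qed.

(** Dropping [w] changes the integrand only on the interval from [w] to [z], where [F w] gives way
    to the value at the preceding point. *)
Lemma lsum_remove x s1 w z s2 :
  lsum x (s1 ++ w :: z :: s2) =
  lsum x (s1 ++ z :: s2) + (F w - F (last x s1)) (g z - g w).
Proof.
rewrite !lsum_cat !lsum_cons -!addrA; congr (_ + _).
set l := last x s1; set L := lsum _ _.
have -> : g z - g l = (g w - g l) + (g z - g w) by rewrite [RHS]addrC subrKA.
move: (g w - g l) (g z - g w) => d1 d2.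
rewrite clinD clin_subE; move: (F l d1) (F l d2) (F w d2) => s c t.
by rewrite -!addrA; congr (_ + _); rewrite [RHS]addrCA [c + _]addrC subrK addrC.
Qed.

End left_sums.

(** * Sums of norms over the blocks of a partition *)

Section blocks.
Variables (R : realType) (E V : normedModType R).
Variables (F : R -> clin E V) (g : R -> E).
Implicit Types (x y : R) (s : seq R) (P : pred R).

(* The points satisfying P cut the list x :: s into blocks; a block with points
   x_0 < ... < x_k contributes the norm of
   \sum_i (F x_i - F x_0) (g x_(i+1) - g x_i). In the recursion, x0 is the first
   point of the current block and v the part of its sum that has been read. *)
Fixpoint block_sum P (v : V) x0 x s : R :=
  if s is y :: s' then
    let v' := v + (F x (g y - g x) - F x0 (g y - g x)) in
    if P y then `|v'| + block_sum P 0 y y s' else block_sum P v' x0 y s'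
  else `|v|.

(** The carried part [v] enters only the norm of the block being read. *)
Lemma block_sum_lip P v v' x0 x s :
  block_sum P v x0 x s <= block_sum P v' x0 x s + `|v - v'|.
Proof.
elim: s x0 x v v' => [|y s IH] x0 x v v' /=.
  by rewrite -{1}(subrKC v' v) ler_normD.
have E1 (d : V) : v - v' = v + d - (v' + d) by rewrite opprD addrACA subrr addr0.
case: ifP => _; last by rewrite (E1 (F x (g y - g x) - F x0 (g y - g x))) IH.
rewrite addrAC lerD2r (E1 (F x (g y - g x) - F x0 (g y - g x))).
by rewrite (le_trans _ (ler_normD _ _))// subrKC.
Qed.

(** As [w] is not a cut, its removal alters the sum of one block only, by the same product as for a
    left sum; [block_sum_lip] carries the change to the end of that block. *)
Lemma block_sum_remove P v x0 x s1 w z s2 : ~~ P w ->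
  block_sum P v x0 x (s1 ++ w :: z :: s2) <=
  block_sum P v x0 x (s1 ++ z :: s2) +
    `|F w - F (last x s1)| * `|g z - g w|.
Proof.
move=> Pw; elim: s1 v x0 x => [|y s1 IH] v x0 x /=; last first.
  by case: ifP => _; rewrite -?addrA ?lerD2l IH.
rewrite (negbTE Pw).
set u := v + _ + _; set u' := v + _.
have E1 : u - u' = F w (g z - g w) - F x (g z - g w).
  rewrite /u /u'.
  have -> : g z - g x = (g w - g x) + (g z - g w) by rewrite [RHS]addrC subrKA.
  move: (g w - g x) (g z - g w) => d1 d2; rewrite !clinD [- (F x0 _ + _)]opprD
    [F x d1 + _ + _]addrACA.
  move: (F x d1 - F x0 d1) (F w d2) (F x d2) (F x0 d2) => e a b c.
  by rewrite [v + (e + _)]addrA opprD addrACA subrr add0r opprB subrKA.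
have E2 : `|F w (g z - g w) - F x (g z - g w)| <= `|F w - F x| * `|g z - g w|.
  exact: clin_norm_le (F w - F x) (g z - g w).
case: (P z).
  rewrite [X in _ <= X]addrAC lerD2r.
  apply: (@le_trans _ _ (`|u'| + `|u - u'|)); last by rewrite E1 lerD2l.
  by rewrite (le_trans _ (ler_normD _ _))// subrKC.
apply: le_trans (block_sum_lip _ _ u' _ _ _) _.
by rewrite E1 lerD2l.
Qed.

(** Each block is then a single interval, with sum zero. This is the end state of the removal. *)
Lemma block_sum_all P x s : all P s -> block_sum P 0 x x s = 0.
Proof.
elim: s x => [|y s IH] x /=; first by rewrite normr0.
by case/andP => -> /IH ->; rewrite subrr add0r normr0 addr0.
Qed.

Lemma block_sum_cat P v x0 x s y s2 : all (predC P) s -> P y ->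
  block_sum P v x0 x (s ++ y :: s2) =
  `|v + lsum F g x (rcons s y) - F x0 (g y - g x)| + block_sum P 0 y y s2.
Proof.
move=> sP Py; elim: s v x sP => [|w s IH] v x /=.
  move=> _; rewrite Py /lsum /= big_seq1/= addrA//.
case/andP => /negbTE -> /IH ->; congr (`|_| + _).
rewrite lsum_cons.
have -> : g y - g x = (g w - g x) + (g y - g w) by rewrite [RHS]addrC subrKA.
move: (g w - g x) (g y - g w) => d1 d2.
by rewrite clinD opprD !addrA; congr (_ - _); exact: addrAC.
Qed.

Fixpoint refine (d : R -> R -> seq R) x s : seq R :=
  if s is y :: s' then d x y ++ y :: refine d y s' else [::].

Lemma last_refine d x s : last x (refine d x s) = last x s.
Proof. by elim: s x => //= y s IH x; rewrite last_cat/= IH. Qed.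

Lemma refine_path (d : R -> R -> seq R) x s :
  (forall u v, u < v -> path <%R u (rcons (d u v) v)) ->
  path <%R x s -> path <%R x (refine d x s).
Proof.
move=> dP; elim: s x => //= y s IH x /andP[xy ys].
by rewrite -cat_rcons cat_path last_rcons dP//= IH.
Qed.

Lemma block_sum_refine (d : R -> R -> seq R) x s :
  (forall u v, u < v -> path <%R u (rcons (d u v) v)) -> path <%R x s ->
  block_sum (mem s) 0 x x (refine d x s) =
  \sum_(w <- zip (x :: s) s)
    `|lsum F g w.1 (rcons (d w.1 w.2) w.2) - F w.1 (g w.2 - g w.1)|.
Proof.
move=> dP.
(* The cuts stay those of the whole list while the induction passes to its tail, so they are
   replaced by any [P] that holds on [s] and fails at the other points beyond [x]. *)
suff gen (P : pred R) : all P s -> (forall z, x < z -> z \notin s -> ~~ P z) ->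
    path <%R x s -> block_sum P 0 x x (refine d x s) =
    \sum_(w <- zip (x :: s) s)
      `|lsum F g w.1 (rcons (d w.1 w.2) w.2) - F w.1 (g w.2 - g w.1)|.
  by apply: gen => //; apply/allP.
elim: s x => [|y s IH] x /=; first by rewrite big_nil normr0.
case/andP=> Py Ps HP /andP[xy ys].
have xyd : path <%R x (rcons (d x y) y) by exact: dP.
have yall : all (> y) s by move: ys; rewrite lt_path_sortedE => /andP[].
rewrite block_sum_cat ?big_cons//; last first.
  apply/allP => z zd; apply: HP.
    move: xyd; rewrite lt_path_sortedE => /andP[/allP + _]; apply.
    by rewrite mem_rcons inE zd orbT.
  have zy : z < y.
    move: xyd => /path_sorted; rewrite lt_sorted_pairwise pairwise_rcons.
    by case/andP => /allP/(_ z zd).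
  rewrite inE negb_or lt_eqF//=; apply/negP => /(allP yall).
  by rewrite /= ltNge ltW.
rewrite add0r; congr (_ + _); apply: IH => // z yz zs; apply: HP.
  exact: lt_trans yz.
by rewrite inE negb_or zs gt_eqF.
Qed.

End blocks.

(** * Comparison of a list of points with a coarser one *)

Section refinement_bounds.
Variables (R : realType) (E V : normedModType R).
Variables (F : R -> clin E V) (g : R -> E) (p q A B a b : R).
Hypotheses (p0 : 0 < p) (q0 : 0 < q) (A0 : 0 < A) (B0 : 0 < B).
Hypotheses (tvF : tv_bound p A F a b) (tvg : tv_bound q B g a b).

(** The points outside [P] are removed one by one; [Phi] is the distance to the coarse left sum and
    ends at 0. *)
Lemma lsum_refine_le c K x s y (P : pred R) : a <= x -> y <= b ->
  path <%R x (rcons s y) ->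
  (forall n, \sum_(1 <= m < n) Num.min c (weak_rate p A m * weak_rate q B m) <= K) ->
  (forall u w v, x <= u -> u < w -> w < v -> v <= y ->
     (forall z, z \in s -> P z -> z <= u \/ v <= z) ->
     `|F w - F u| * `|g v - g w| <= c) ->
  `|lsum F g x (rcons s y) - lsum F g x (rcons [seq z <- s | P z] y)| <= K.
Proof.
move=> ax yb xsy HK Hc.
set L := lsum F g x (rcons (seq.filter _ _) _).
pose Phi s' := `|lsum F g x (rcons s' y) - L|.
rewrite -/(Phi s).
have Phi0 : Phi [seq z <- s | P z] = 0 by rewrite /Phi subrr normr0.
have := @removal_le R _ _ p q A B (2 * A `^ p^-1) c a b x y F g P Phi s
  p0 q0 A0 B0 tvF tvg ax yb xsy _ Hc _.
rewrite Phi0 add0r => H; apply: le_trans (H _ _) _.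
- by move=> u w au uw wb; apply: (tv_bound_osc p0 tvF).
- move=> s1 w s2 Pw; rewrite /Phi.
  have : exists z s3, rcons s2 y = z :: s3 /\ head y s2 = z.
    by case: (s2) => [|z s3]; [exists y, [::]|exists z, (rcons s3 y)].
  move=> [z [s3 [E1 ->]]].
  rewrite !rcons_cat/= E1 lsum_remove addrAC.
  apply: le_trans (ler_normD _ _) _; rewrite lerD2l.
  exact: clin_norm_le.
- apply: le_trans (HK (count (predC P) s).+1); apply: ler_sum => m _.
  rewrite le_min !ge_min lexx/=; apply/orP; right.
  by rewrite ler_wpM2r ?weak_rate_ge0// ge_min lexx orbT.
Qed.

(** The points inserted in all the intervals are removed in one common order, so a single [K] bounds
    the total, whatever the number of intervals. *)
Lemma sum_refine_le o K (d : R -> R -> seq R) x s :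
  (forall u v, u < v -> path <%R u (rcons (d u v) v)) ->
  a <= x -> path <%R x s -> last x s <= b ->
  (forall u w, a <= u -> u <= w -> w <= b -> `|F w - F u| <= o) ->
  (forall n, \sum_(1 <= m < n) Num.min o (weak_rate p A m) * weak_rate q B m <= K) ->
  \sum_(w <- zip (x :: s) s)
    `|lsum F g w.1 (rcons (d w.1 w.2) w.2) - F w.1 (g w.2 - g w.1)| <= K.
Proof.
move=> dP ax xs sb Ho HK; rewrite -block_sum_refine//.
have rP := refine_path dP xs.
have lr := last_refine d x s.
case/lastP: (refine d x s) rP lr => [|r y] rP.
  by move=> _ /=; rewrite normr0; have := HK 0%N; rewrite big_geq.
rewrite last_rcons => yE.
have ys : y \in s \/ s = [::].
  case: (s) yE => [|z s'] /= ->; [by right|by left; rewrite mem_last].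
have {}ys : y \in s.
  case: ys => // s0; move: yE rP; rewrite s0/= => ->.
  rewrite lt_path_sortedE => /andP[/allP/(_ x)].
  by rewrite mem_rcons mem_head ltxx => /(_ isT).
pose Phi s' := block_sum F g (mem s) 0 x x (rcons s' y).
rewrite -/(Phi r).
have Phi0 : Phi [seq z <- r | z \in s] = 0.
  by apply: block_sum_all; rewrite all_rcons /= ys filter_all.
have yb : y <= b by rewrite yE.
have := @removal_le R _ _ p q A B o (o * (2 * B `^ q^-1)) a b x y F g (mem s) Phi r
  p0 q0 A0 B0 tvF tvg ax yb rP Ho _ _.
rewrite Phi0 add0r => H; apply: le_trans (H _ _) _.
- move=> u w v xu uw wv vy _.
  have au := le_trans ax xu; have vb := le_trans vy yb.
  rewrite ler_pM// ?Ho ?(ltW uw)//; first by rewrite (le_trans (ltW wv)).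
  by apply: (tv_bound_osc q0 tvg); rewrite ?(ltW wv) ?(le_trans au (ltW uw)).
- move=> s1 w s2 Pw; rewrite /Phi.
  have : exists z s3, rcons s2 y = z :: s3 /\ head y s2 = z.
    by case: (s2) => [|z s3]; [exists y, [::]|exists z, (rcons s3 y)].
  move=> [z [s3 [E1 ->]]].
  by rewrite !rcons_cat/= E1 block_sum_remove.
- apply: le_trans (HK _); apply: ler_sum => m _.
  by rewrite ge_min lexx orbT.
Qed.

End refinement_bounds.

(** * Partitions, meshes and tags *)

Section partitions.
Variable R : realType.
Implicit Types (a t x y : R) (s : seq R).

Lemma zip_cat_path x s1 s2 : zip (x :: s1 ++ s2) (s1 ++ s2) =
  zip (x :: s1) s1 ++ zip (last x s1 :: s2) s2.
Proof. by elim: s1 x => //= y s1 IH x; rewrite -IH. Qed.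

Lemma mesh_leP a (P : seq R * seq R) e : 0 <= e ->
  (forall w, w \in zip (a :: P.1) P.1 -> w.2 - w.1 <= e) -> mesh a P <= e.
Proof.
move=> e0 h; rewrite /mesh (big_zip_nth _ _ (fun u v => v - u)) big_seq.
exact: bigmax_le.
Qed.

Lemma le_mesh a (P : seq R * seq R) w : w \in zip (a :: P.1) P.1 ->
  w.2 - w.1 <= mesh a P.
Proof.
move=> h; rewrite /mesh (big_zip_nth _ _ (fun u v => v - u)).
exact: (@le_bigmax_seq _ _ _ _ _ _ xpredT (fun w : R * R => w.2 - w.1)).
Qed.

Lemma mesh_ge0 a (P : seq R * seq R) : 0 <= mesh a P.
Proof. exact: bigmax_ge_id. Qed.

(** An interval with no point of [s] in its interior lies inside a single gap. *)
Lemma gap_lt x s d u v : (forall w, w \in zip (x :: s) s -> w.2 - w.1 < d) ->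
  x <= u -> u < v -> v <= last x s -> (forall z, z \in s -> z <= u \/ v <= z) ->
  v - u < d.
Proof.
elim: s x => [|y s IH] x h xu uv /= vl hz.
  by have := le_lt_trans xu uv; rewrite ltNge vl.
case: (hz y); rewrite ?mem_head// => hy.
  apply: (IH y) => // [w ws|z zs]; first by apply: h; rewrite inE ws orbT.
  by apply: hz; rewrite inE zs orbT.
have := h (x, y); rewrite inE eqxx => /(_ isT)/=.
by apply: le_lt_trans; rewrite lerB.
Qed.

Lemma tagged_partition_left a t s : itv_partition a t s ->
  tagged_partition a t (s, belast a s).
Proof.
move=> as_; split => //=; first by rewrite size_belast.
move=> i is_; have -> : nth a (belast a s) i = nth a (a :: s) i.
  by rewrite lastI nth_rcons size_belast is_.
rewrite lexx /=; case: as_ => /path_ltW + _.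
by move=> /(pathP a)/(_ i is_).
Qed.

Definition uniform_points (n : nat) x y : seq R :=
  [seq x + (y - x) * (k%:R / n.+1%:R) | k <- iota 1 n].

Lemma uniform_points_rcons n x y : rcons (uniform_points n x y) y =
  [seq x + (y - x) * (k%:R / n.+1%:R) | k <- iota 1 n.+1].
Proof.
have -> : iota 1 n.+1 = rcons (iota 1 n) n.+1.
  by rewrite -[X in iota _ X]addn1 iotaD/= cats1.
rewrite map_rcons; congr rcons.
by rewrite divff ?pnatr_eq0// mulr1 subrKC.
Qed.

Lemma path_uniform n x y : x < y -> path <%R x (rcons (uniform_points n x y) y).
Proof.
move=> xy; rewrite uniform_points_rcons.
pose F (k : nat) : R := x + (y - x) * (k%:R / n.+1%:R).
suff : sorted <%R [seq F k | k <- iota 0 n.+2].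
  by rewrite /= {1}/F mul0r mulr0 addr0.
apply: (homo_sorted (e := ltn)); last exact: iota_ltn_sorted.
move=> i j /= ij; rewrite ltrD2l ltr_pM2l ?subr_gt0//.
by rewrite ltr_pM2r ?invr_gt0 ?ltr0n// ltr_nat.
Qed.

Lemma gap_uniform n x y w : w \in zip (x :: rcons (uniform_points n x y) y) (rcons (uniform_points n x y) y) ->
  w.2 - w.1 = (y - x) / n.+1%:R.
Proof.
rewrite uniform_points_rcons; pose F (k : nat) : R := x + (y - x) * (k%:R / n.+1%:R).
suff gen k m : w \in zip [seq F i | i <- iota m k.+1] [seq F i | i <- iota m.+1 k] ->
    w.2 - w.1 = (y - x) / n.+1%:R.
  move=> h; apply: (gen n.+1 0%N); move: h.
  have F0 : F 0%N = x by rewrite /F mul0r mulr0 addr0.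
  by rewrite /= F0.
elim: k m => //= k IH m; rewrite inE => /predU1P[->/=|]; last exact: IH.
by rewrite /F -[m.+1%:R]natr1 opprD addrACA subrr add0r -mulrBr -mulrBl addrAC subrr add0r mul1r.
Qed.

Lemma itv_partition_uniform n x y : x < y -> itv_partition x y (rcons (uniform_points n x y) y).
Proof. by move=> xy; split; [exact: path_uniform|rewrite last_rcons]. Qed.

Lemma mesh_cvg0 a (P : nat -> seq R * seq R) C :
  (forall n w, w \in zip (a :: (P n).1) (P n).1 -> w.2 - w.1 <= C / n.+1%:R) ->
  0 <= C -> mesh a (P n) @[n --> \oo] --> (0 : R).
Proof.
move=> h C0.
have h0 : C * n.+1%:R^-1 @[n --> \oo] --> (0 : R).
  rewrite -[X in _ --> X](mulr0 C); by apply: cvgM; [exact: cvg_cst|exact: cvg_harmonic].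
apply: (squeeze_cvgr _ (cvg_cst (0 : R)) h0).
apply: nearW => n; rewrite mesh_ge0/=; apply: mesh_leP => [|w]; last exact: h.
by rewrite divr_ge0.
Qed.

(** In the list that merges points and tags, the gaps from a tag to the next point only add
    nonnegative terms. *)
Lemma interleave (G : R -> R -> R) d x s ts :
  (forall u v, 0 <= G u v) -> size ts = size s ->
  (forall i, (i < size s)%N -> nth d (x :: s) i <= nth d ts i <= nth d s i) ->
  exists l, [/\ path <=%R x l, last x l = last x s &
    \sum_(0 <= i < size s) G (nth d (x :: s) i) (nth d ts i) <=
    \sum_(w <- zip (x :: l) l) G w.1 w.2].
Proof.
move=> G0; elim: s ts x => [|y s IH] [|xi ts] x //= => [_ _|[szs] h].
  by exists [::]; rewrite big_geq// big_nil.
have /andP[/= h1 h2] := h 0%N isT.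
have [l [pl ll E]] := IH ts y szs (fun i => h i.+1).
exists [:: xi, y & l]; rewrite /= h1 h2 pl; split => //.
rewrite big_nat_recl// big_cons/= lerD2l big_cons (le_trans E)// lerDr.
exact: G0.
Qed.

End partitions.

(** * Moving tags, and the joint smallness of the oscillations *)

Section existence.
Variables (R : realType) (E V : completeNormedModType R).
Variables (F : R -> clin E V) (g : R -> E) (p q A B a b : R).
Hypotheses (p0 : 0 < p) (q0 : 0 < q) (A0 : 0 < A) (B0 : 0 < B).
Hypotheses (tvF : tv_bound p A F a b) (tvg : tv_bound q B g a b).

Lemma RS_sum_left x s : RS_sum F g x (s, belast x s) = lsum F g x s.
Proof.
rewrite /lsum -(big_zip_nth _ _ (fun u v => F u (g v - g u)) x).
rewrite /RS_sum; apply: eq_big_nat => i /andP[_ is_] /=.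
by rewrite [x :: s]lastI nth_rcons size_belast is_.
Qed.

(** Moving the tags to the left end points changes the sum by products of an increment of [F] up to
    the tag and an increment of [g]. Both families are weakly summable, the first by [interleave],
    and each product is at most [c]. *)
Lemma RS_sum_lsum_le c K t (P : seq R * seq R) : t <= b ->
  tagged_partition a t P ->
  (forall n, \sum_(1 <= m < n) Num.min c (weak_rate p A m * weak_rate q B m) <= K) ->
  (forall x y u v, x \in `[a, b] -> y \in `[a, b] -> u \in `[a, b] -> v \in `[a, b] ->
    `|x - u| <= mesh a P -> `|y - u| <= mesh a P -> `|v - u| <= mesh a P ->
    `|F x - F y| * `|g v - g u| <= c) ->
  `|RS_sum F g a P - lsum F g a P.1| <= K.
Proof.
case: P => s ts tb [] /= [ps /eqP ls] szs hts HK Hc.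
rewrite -RS_sum_left /RS_sum -sumrB/=.
pose u i := `|F (nth a ts i) - F (nth a (a :: s) i)|.
pose v i := `|g (nth a s i) - g (nth a (a :: s) i)|.
apply: le_trans (ler_norm_sum _ _ _) _.
apply: (@le_trans _ _ (\sum_(0 <= i < size s) u i * v i)).
  apply: ler_sum_nat => i /andP[_ is_].
  have -> : nth a (belast a s) i = nth a (a :: s) i.
    by rewrite [a :: s]lastI nth_rcons size_belast is_.
  exact: clin_norm_le (F (nth a ts i) - F (nth a (a :: s) i)) _.
have b_i i : (i < (size s).+1)%N -> nth a (a :: s) i \in `[a, b].
  move=> is_; have ip : itv_partition a t s by split => //; apply/eqP.
  rewrite (set_nth_default t)// in_itv/= (itv_partition_nth_ge is_ ip)/=.
  by rewrite (le_trans (itv_partition_nth_le is_ ip)).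
apply: le_trans (HK (size (index_iota 0 (size s))).+1).
apply: (sum_mul_weak_le p0 q0 A0 B0); rewrite /u /v.
- by move=> i.
- by move=> i.
- move=> i; rewrite mem_index_iota/= => is_.
  have /andP[h1 h2] := hts i is_.
  have bi := b_i i (ltnW is_); have bi1 := b_i i.+1 is_; rewrite /= in bi1.
  have gap : nth a s i - nth a (a :: s) i <= mesh a (s, ts).
    rewrite /mesh; apply: (@le_bigmax_seq _ _ _ _ _ _ xpredT (fun i => nth a s i - nth a (a :: s) i)) => //.
    by rewrite mem_index_iota.
  apply: Hc => //.
  + move: bi bi1; rewrite !in_itv/= => /andP[k1 k2] /andP[k3 k4].
    by rewrite (le_trans k1)//= (le_trans h2).
  + by rewrite ger0_norm ?subr_ge0// (le_trans _ gap)// lerB.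
  + by rewrite subrr normr0 mesh_ge0.
  + by rewrite ger0_norm ?subr_ge0// (le_trans h1).
- move=> d d0.
  pose G (x y : R) := Num.max (`|F y - F x| - d) 0.
  have [|l [pl ll Gl]] := interleave (G := G) _ szs hts.
    by move=> ? ?; rewrite le_max lexx orbT.
  by apply: le_trans Gl _; apply: tvF => //; rewrite ll ls.
- move=> d d0.
  rewrite (big_zip_nth _ _ (fun x y => Num.max (`|g y - g x| - d) 0)).
  by apply: tvg => //; [exact: path_ltW|rewrite ls].
Qed.

Hypothesis pq : 1 < p^-1 + q^-1.
Hypothesis disc : discontinuities F a b `&` discontinuities g a b = set0.

(** At every point of [a, b] one of [F] and [g] is continuous while the other is bounded, so the
    product is small nearby. Compactness makes the radius uniform. *)
Lemma oscillation_product_small c : 0 < c -> exists2 d : R, 0 < d &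
  forall z, z \in `[a, b] -> forall x y u v, x \in `[a, b] -> y \in `[a, b] ->
    u \in `[a, b] -> v \in `[a, b] ->
    `|x - z| < d -> `|y - z| < d -> `|u - z| < d -> `|v - z| < d ->
    `|F x - F y| * `|g v - g u| <= c.
Proof.
move=> c0.
(* The added 1 makes the bound positive, so that [c] can be divided by it. *)
have osc (W : normedModType R) r D (h : R -> W) : 0 < r -> tv_bound r D h a b ->
    forall x y, x \in `[a, b] -> y \in `[a, b] -> `|h x - h y| <= 2 * D `^ r^-1 + 1.
  move=> r0 tv x y; rewrite !in_itv/= => /andP[ax xb] /andP[ay yb].
  rewrite (@le_trans _ _ (2 * D `^ r^-1))// ?lerDl//.
  have [xy|/ltW yx] := leP x y; last exact: (tv_bound_osc r0 tv).
  by rewrite distrC; exact: (tv_bound_osc r0 tv).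
have oF := osc _ _ _ _ p0 tvF; have og := osc _ _ _ _ q0 tvg.
set oF_ := _ + 1 in oF; set og_ := _ + 1 in og.
have oF0 : 0 < oF_ by rewrite ltr_wpDl// mulr_ge0// powR_ge0.
have og0 : 0 < og_ by rewrite ltr_wpDl// mulr_ge0// powR_ge0.
have loc (W : normedModType R) (h : R -> W) z e : z \in `[a, b] ->
    ~ discontinuities h a b z -> 0 < e -> exists2 r : R, 0 < r &
    forall x y, x \in `[a, b] -> y \in `[a, b] -> `|x - z| < r -> `|y - z| < r ->
      `|h x - h y| <= e.
  move=> zab hz e0.
  have ch : h x @[x --> within `[a, b] (nbhs z)] --> h z.
    by apply: contrapT => nh; apply: hz; split.
  have e20 : 0 < e / 2 by rewrite divr_gt0.
  have /cvgrPdist_lt/(_ _ e20) := ch.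
  rewrite /prop_near1 /within/= => /nbhs_ballP[r /= r0 hr].
  exists r => // x y xab yab xr yr.
  have hx := hr x; have hy := hr y.
  rewrite [e]splitr (le_trans (ler_distD (h z) _ _))// lerD// ltW//.
    by rewrite distrC hx// -ball_normE /= distrC.
  by rewrite hy// -ball_normE /= distrC.
pose Q (d z : R) := forall x y u v, x \in `[a, b] -> y \in `[a, b] ->
    u \in `[a, b] -> v \in `[a, b] ->
    `|x - z| < d -> `|y - z| < d -> `|u - z| < d -> `|v - z| < d ->
    `|F x - F y| * `|g v - g u| <= c.
have locQ z : z \in `[a, b] -> exists2 r : R, 0 < r & Q r z.
  move=> zab; have : ~ discontinuities F a b z \/ ~ discontinuities g a b z.
    apply/not_andP => h; suff : set0 z by [].
    by rewrite -disc.
  case=> hz.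
    have [r r0 hr] := loc _ F z _ zab hz (divr_gt0 c0 og0).
    exists r => // x y u v xab yab uab vab xr yr ur vr.
    rewrite -(divfK (lt0r_neq0 og0) c) ler_pM//; [exact: hr|exact: og].
  have [r r0 hr] := loc _ g z _ zab hz (divr_gt0 c0 oF0).
  exists r => // x y u v xab yab uab vab xr yr ur vr.
  rewrite mulrC -(divfK (lt0r_neq0 oF0) c) ler_pM//; [exact: hr|exact: oF].
have cov := (@compact_near_coveringP R `[a, b]).1 (@segment_compact R a b).
have := cov _ (0^'+ : set_system R) Q _.
have /[swap] /[apply] : forall z, `[a, b]%classic z ->
    \forall z' \near z & d \near (0:R)^'+, Q d z'.
  move=> z zab; have [r r0 hr] := locQ z zab.
  have nz : \forall z' \near z, `|z' - z| < r / 2.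
    apply/nbhs_ballP; exists (r / 2) => /=; first by rewrite divr_gt0.
    by move=> w; rewrite -ball_normE /= distrC.
  near=> z' d => x y u v xab yab uab vab xr yr ur vr.
  have zz : `|z' - z| < r / 2.
    by near: z'.
  have dr : d < r / 2 by near: d; apply: nbhs_right_lt; rewrite divr_gt0.
  have tri w : `|w - z'| < d -> `|w - z| < r.
    move=> wd; rewrite (le_lt_trans (ler_distD z' _ _))// [r]splitr ltrD//.
    exact: lt_trans dr.
  by apply: hr => //; exact: tri.
move=> H.
have [d [d0 dQ]] := filter_ex (filterI (nbhs_right_gt (0 : R)) H).
by exists d => // z zab; exact: dQ.
Unshelve. all: by end_near. Qed.

End existence.

(** * Existence and additivity of the integral *)

Section integral.
Variables (R : realType) (E V : completeNormedModType R).
Variables (F : R -> clin E V) (g : R -> E) (p q A B a b : R).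
Hypotheses (p0 : 0 < p) (q0 : 0 < q) (A0 : 0 < A) (B0 : 0 < B).
Hypotheses (tvF : tv_bound p A F a b) (tvg : tv_bound q B g a b).
Hypothesis pq : 1 < p^-1 + q^-1.
Hypothesis disc : discontinuities F a b `&` discontinuities g a b = set0.

(** The product of the rates is a constant times m^(-(1/p + 1/q)), which is summable. *)
Lemma sum_min_weak_rate_small K : 0 < K -> exists2 c : R, 0 < c &
  forall n, \sum_(1 <= m < n) Num.min c (weak_rate p A m * weak_rate q B m) <= K.
Proof.
move=> K0; pose L := 2 * (3 * A) `^ p^-1 * (2 * (3 * B) `^ q^-1).
have L0 : 0 < L by rewrite !mulr_gt0 ?powR_gt0 ?mulr_gt0.
have [c c0 hc] := sum_min_powR_small pq L0 K0.
exists c => // n; apply: le_trans (hc n); apply: ler_sum_nat => m /andP[m0 _].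
have mgt0 : 0 < m%:R :> R by rewrite ltr0n.
rewrite (_ : weak_rate p A m * weak_rate q B m = L * m%:R `^ (- (p^-1 + q^-1)))//.
have pw r D : 0 < D -> (3 * D / m%:R) `^ r = (3 * D) `^ r * m%:R `^ (- r).
  move=> D0; rewrite powRM ?invr_ge0 ?(ltW mgt0) ?mulr_ge0 ?(ltW D0)//.
  by rewrite -[m%:R^-1]powR_inv1 ?(ltW mgt0)// -powRrM mulN1r.
rewrite /weak_rate !pw// opprD powRD; last by rewrite (gt_eqF mgt0) implybT.
by rewrite /L; ring.
Qed.

(** Both sums are compared with that of the common refinement [r]. Each removal involves points of
    one gap of the coarser partition, all closer than [d], and so costs at most [c]. *)
Lemma lsum_partition_close c K d t s1 s2 : t <= b ->
  (forall n, \sum_(1 <= m < n) Num.min c (weak_rate p A m * weak_rate q B m) <= K) ->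
  (forall z, z \in `[a, b] -> forall x y u v, x \in `[a, b] -> y \in `[a, b] ->
    u \in `[a, b] -> v \in `[a, b] ->
    `|x - z| < d -> `|y - z| < d -> `|u - z| < d -> `|v - z| < d ->
    `|F x - F y| * `|g v - g u| <= c) ->
  itv_partition a t s1 -> itv_partition a t s2 ->
  (forall w, w \in zip (a :: s1) s1 -> w.2 - w.1 < d) ->
  (forall w, w \in zip (a :: s2) s2 -> w.2 - w.1 < d) ->
  `|lsum F g a s1 - lsum F g a s2| <= K + K.
Proof.
move=> tb HK Hd [ps1 /eqP ls1] [ps2 /eqP ls2] gap1 gap2.
have K0 : 0 <= K by have := HK 0%N; rewrite big_geq.
case/lastP: s1 ps1 ls1 gap1 => [_ /= at_ _|r1 t1].
  have -> : s2 = [::] by apply: (@itv_partitionxx _ _ a); split=> //; rewrite ls2 at_.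
  by rewrite subrr normr0 addr_ge0.
rewrite last_rcons => ps1 t1E; rewrite {}t1E {t1} in ps1 *; move=> gap1.
have at_ : a < t.
  by move: ps1; rewrite lt_path_sortedE => /andP[/allP/(_ t)]; rewrite mem_rcons mem_head => ->.
case/lastP: s2 ps2 ls2 gap2 => [_ /= at2 _|r2 t2]; first by rewrite at2 ltxx in at_.
rewrite last_rcons => ps2 t2E; rewrite {}t2E {t2} in ps2 *; move=> gap2.
pose r := sort <=%R (undup (r1 ++ r2)).
have memr z : (z \in r) = (z \in r1) || (z \in r2).
  by rewrite mem_sort mem_undup mem_cat.
have srt r' : path <%R a (rcons r' t) -> [/\ sorted <%R r', all (> a) r' & all (< t) r'].
  rewrite lt_path_sortedE all_rcons => /andP[/andP[_ ->]].
  by rewrite !lt_sorted_pairwise pairwise_rcons => /andP[-> ->].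
have [so1 ga1 lt1] := srt _ ps1; have [so2 ga2 lt2] := srt _ ps2.
have sor : sorted <%R r.
  by rewrite lt_sorted_uniq_le sort_uniq undup_uniq (sort_sorted le_total).
have pr : path <%R a (rcons r t).
  rewrite lt_path_sortedE all_rcons at_ lt_sorted_pairwise pairwise_rcons.
  rewrite -lt_sorted_pairwise sor andbT/=; apply/andP; split; apply/allP => z;
    rewrite memr => /orP[]; by [move/(allP ga1)|move/(allP ga2)|move/(allP lt1)|move/(allP lt2)].
have one r' : (forall z, z \in r' -> z \in r) -> sorted <%R r' ->
    (forall w, w \in zip (a :: rcons r' t) (rcons r' t) -> w.2 - w.1 < d) ->
    `|lsum F g a (rcons r t) - lsum F g a (rcons r' t)| <= K.
  move=> r'r sor' gap'.
  have E1 : [seq z <- r | z \in r'] = r'.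
    apply: (irr_sorted_eq lt_trans (@ltxx _ _)) => //.
      exact: (sorted_filter lt_trans).
    by move=> z; rewrite mem_filter; apply/andP/idP => [[]//|zr']; split => //; exact: r'r.
  rewrite -{1}E1; apply: (lsum_refine_le p0 q0 A0 B0 tvF tvg) HK _ => //.
  move=> u w v au uw wv vt hz.
  have vu : v - u < d.
    apply: (gap_lt gap') => //; first exact: lt_trans wv.
      by rewrite last_rcons.
    move=> z; rewrite mem_rcons inE => /predU1P[->|zr']; first by right.
    by apply: hz => //; exact: r'r.
  have uv := lt_trans uw wv.
  have inab z : u <= z -> z <= v -> z \in `[a, b].
    by move=> uz zv; rewrite in_itv/= (le_trans au)// (le_trans zv)// (le_trans vt).
  have near_ z : u <= z -> z <= v -> `|z - u| < d.
    by move=> uz zv; rewrite ger0_norm ?subr_ge0// (le_lt_trans _ vu)// lerB.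
  apply: (Hd u); rewrite ?inab ?near_ ?(ltW uw) ?(ltW wv) ?(ltW uv) ?lexx//.
rewrite (le_trans (ler_distD (lsum F g a (rcons r t)) _ _))// lerD//.
  by rewrite distrC one// => z; rewrite memr => ->.
by rewrite one// => z; rewrite memr orbC => ->.
Qed.

Lemma RS_sum_cauchy eps t : 0 < eps -> t <= b -> exists2 d : R, 0 < d &
  forall P Q : seq R * seq R, tagged_partition a t P -> tagged_partition a t Q ->
    mesh a P < d -> mesh a Q < d -> `|RS_sum F g a P - RS_sum F g a Q| <= eps.
Proof.
(* Each of [P] and [Q] costs eps/4 for moving its tags and eps/4 for the passage to the common
   refinement. *)
move=> eps0 tb; have K0 : 0 < eps / 4 by rewrite divr_gt0.
have [c c0 HK] := sum_min_weak_rate_small K0.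
have [d d0 Hd] := oscillation_product_small p0 q0 tvF tvg disc c0.
exists d => // P Q tP tQ mP mQ.
have tag P' : tagged_partition a t P' -> mesh a P' < d ->
    `|RS_sum F g a P' - lsum F g a P'.1| <= eps / 4.
  move=> tP' mP'; apply: (RS_sum_lsum_le p0 q0 A0 B0 tvF tvg tb tP' HK).
  move=> x y u v xab yab uab vab xu yu vu.
  apply: (Hd u) => //; rewrite ?subrr ?normr0// (le_lt_trans _ mP')//.
have gap P' : mesh a P' < d -> forall w, w \in zip (a :: P'.1) P'.1 -> w.2 - w.1 < d.
  by move=> mP' w ws; rewrite (le_lt_trans (le_mesh ws)).
have hP := tag _ tP mP; have hQ := tag _ tQ mQ.
case: (tP) (tQ) => iP _ _ [iQ _ _].
have h := lsum_partition_close tb HK Hd iP iQ (gap _ mP) (gap _ mQ).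
rewrite (le_trans (ler_distD (lsum F g a P.1) _ _))//.
have -> : eps = eps / 4 + (eps / 4 + eps / 4 + eps / 4) by lra.
rewrite lerD// (le_trans (ler_distD (lsum F g a Q.1) _ _))// lerD//.
by rewrite distrC.
Qed.

Lemma RS_integral_exists t : a <= t -> t <= b -> exists v : V, is_RS_integral F g a t v.
Proof.
rewrite le_eqVlt => /predU1P[<- _|at_ tb].
  exists 0 => P tP _; have -> : (fun n => RS_sum F g a (P n)) = cst 0.
    apply/funext => n /=; have [iP _ _] := tP n.
    by rewrite /RS_sum (itv_partitionxx iP) big_geq.
  exact: cvg_cst.
(* Left sums on uniform partitions converge by completeness; their limit then serves every sequence
   of tagged partitions with mesh tending to 0. *)
pose P n := (rcons (uniform_points n a t) t, belast a (rcons (uniform_points n a t) t)).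
have tP n : tagged_partition a t (P n).
  exact/tagged_partition_left/itv_partition_uniform.
have mP : mesh a (P n) @[n --> \oo] --> (0 : R).
  apply: (@mesh_cvg0 _ a _ (t - a)); last by rewrite subr_ge0 ltW.
  by move=> n w /gap_uniform ->.
have small (P' : nat -> seq R * seq R) d : 0 < d -> mesh a (P' n) @[n --> \oo] --> (0 : R) ->
    \forall n \near \oo, mesh a (P' n) < d.
  move=> d0 /cvgrPdist_lt/(_ _ d0); apply: filterS => n.
  by rewrite sub0r normrN ger0_norm// mesh_ge0.
have cP : cvg (RS_sum F g a (P n) @[n --> \oo]).
  apply/cauchy_cvgP/cauchyP => eps eps0; have e20 : 0 < eps / 2 by rewrite divr_gt0.
  have [d d0 hd] := RS_sum_cauchy e20 tb.
  have [N _ HN] := small P d d0 mP.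
  exists (RS_sum F g a (P N)); exists N => // n /= Nn.
  rewrite -ball_normE /= (le_lt_trans (hd _ _ (tP N) (tP n) (HN _ _) (HN _ _)))//=.
  by rewrite ltr_pdivrMr// ltr_pMr// ltr1n.
exists (lim (RS_sum F g a (P n) @[n --> \oo])) => P' tP' mP'.
apply/cvgrPdist_le => eps eps0; have e20 : 0 < eps / 2 by rewrite divr_gt0.
have [d d0 hd] := RS_sum_cauchy e20 tb.
have h1 := small P' d d0 mP'.
have /cvgrPdist_le/(_ _ e20) h2 := cP.
apply: filterS h1 => n hn.
have [m [hm1 hm2]] := filter_ex (filterI (small P d d0 mP) h2).
rewrite (le_trans (ler_distD (RS_sum F g a (P m)) _ _))// [eps]splitr lerD//.
exact: hd.
Qed.

(** Partitions of [a, s] and [s, t] join to one of [a, t], and the left sum over [s, t] is the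
    difference of the two others. *)
Lemma RS_integral_increment s t v w : a <= s -> s < t ->
  is_RS_integral F g a s v -> is_RS_integral F g a t w ->
  lsum F g s (rcons (uniform_points n s t) t) @[n --> \oo] --> w - v.
Proof.
move=> as_ st hv hw.
(* For [s = a] the list must be empty: uniform points followed by [s] would repeat [a], whereas
   partitions increase strictly. *)
pose l n := if s == a then [::] else rcons (uniform_points n a s) s.
have il n : itv_partition a s (l n).
  rewrite /l; case: eqVneq => [->|sa]; first by split=> //=.
  by apply: itv_partition_uniform; rewrite lt_neqAle eq_sym sa.
have it n : itv_partition a t (l n ++ rcons (uniform_points n s t) t).
  case: (il n) => pl /eqP ll; split; first by rewrite cat_path pl ll path_uniform.
  by rewrite last_cat last_rcons.
have left u (m : nat -> seq R) C x : is_RS_integral F g a u x ->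
    (forall n, itv_partition a u (m n)) ->
    (forall n w, w \in zip (a :: m n) (m n) -> w.2 - w.1 <= C / n.+1%:R) -> 0 <= C ->
    lsum F g a (m n) @[n --> \oo] --> x.
  move=> hx mu hm C0.
  under eq_fun do rewrite -RS_sum_left.
  apply: hx; first by move=> n; exact: tagged_partition_left.
  exact: (@mesh_cvg0 _ a (fun n => (m n, belast a (m n))) C).
have gl n x : x \in zip (a :: l n) (l n) -> x.2 - x.1 <= (t - a) / n.+1%:R.
  rewrite /l; case: eqVneq => [//|_] /gap_uniform ->.
  by rewrite ler_pM2r ?invr_gt0 ?ltr0n// lerB// ltW.
have ta : 0 <= t - a by rewrite subr_ge0 (le_trans as_)// ltW.
have c1 := left s l _ _ hv il gl ta.
have c2 : lsum F g a (l n ++ rcons (uniform_points n s t) t) @[n --> \oo] --> w.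
  apply: (left t (fun n => l n ++ rcons (uniform_points n s t) t) _ _ hw it _ ta) => n x; rewrite zip_cat_path mem_cat.
  case/orP => [|]; first exact: gl.
  have [_ /eqP ->] := il n; move=> /gap_uniform ->.
  by rewrite ler_pM2r ?invr_gt0 ?ltr0n// lerB.
have -> : (fun n => lsum F g s (rcons (uniform_points n s t) t)) =
    (fun n => lsum F g a (l n ++ rcons (uniform_points n s t) t) - lsum F g a (l n)).
  by apply/funext => n; rewrite lsum_cat addrAC subrr add0r; have [_ /eqP ->] := il n.
exact: cvgB c2 c1.
Qed.

End integral.

(** * The total cost of removal, and bounds for truncated variations *)

Section integral_variation.
Variable R : realType.
Implicit Types (p q A B o : R).

(** With nu = A / o^p, the first factor is at most a constant times o min(1, (nu/m)^(1/p)), and Y =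
    o nu^(1 - 1/q) B^(1/q); this reduces the sum to [sum_min_powR_le]. The bound assumed on [o]
    becomes 2^(-p) <= nu. *)
Lemma sum_min_weak_rate_le p q : 1 < p -> 1 < q -> 1 < p^-1 + q^-1 ->
  exists2 C : R, 0 < C & forall A B o : R, 0 < A -> 0 < B -> 0 < o ->
    o <= 2 * A `^ p^-1 ->
    let Y := A `^ (1 - q^-1) * o `^ (1 + p / q - p) * B `^ q^-1 in
    o * B `^ q^-1 <= C * Y /\
    forall n, \sum_(1 <= m < n) Num.min o (weak_rate p A m) * weak_rate q B m
                <= C * Y.
Proof.
move=> p1 q1 pq; have [C C0 HC] := sum_min_powR_le p1 q1 pq.
have p0 : 0 < p by lra.
have q0 : 0 < q by lra.
have iq1 : 0 < 1 - q^-1 by rewrite subr_gt0 invf_lt1.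
pose c1 : R := (2 `^ (- p)) `^ (1 - q^-1).
have c10 : 0 < c1 by rewrite !powR_gt0.
(* [c1^-1] serves the first estimate, as nu^(1 - 1/q) >= c1. The 36 is the square of 6, which bounds
   the factor 2 3^(1/r) of each rate. *)
exists (c1^-1 + 36 * C); first by rewrite addr_gt0 ?invr_gt0 ?mulr_gt0.
move=> A B o A0 B0 o0 oA Y.
pose nu := A / o `^ p.
have op0 : 0 < o `^ p by rewrite powR_gt0.
have nu0 : 0 < nu by rewrite divr_gt0.
have AE : A = nu * o `^ p by rewrite /nu divfK ?gt_eqF.
have nu_ge : 2 `^ (- p) <= nu.
  rewrite /nu ler_pdivlMr// powRN mulrC ler_pdivrMr ?powR_gt0// mulrC.
  have -> : A = (A `^ p^-1) `^ p by rewrite -powRrM mulVf ?gt_eqF// powRr1// ltW.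
  rewrite -powRM ?powR_ge0//.
  by rewrite (ge0_ler_powR (ltW p0)) ?nnegrE ?(ltW o0) ?mulr_ge0 ?powR_ge0.
have YE : Y = o * nu `^ (1 - q^-1) * B `^ q^-1.
  rewrite /Y AE powRM ?(ltW nu0) ?(ltW op0)// -powRrM.
  rewrite -[X in _ = X * _ * _](powRr1 (ltW o0)).
  rewrite (_ : 1 + p / q - p = 1 + - (p * (1 - q^-1))); last by ring.
  rewrite (powRD (x := o)); last by rewrite (gt_eqF o0) implybT.
  rewrite powRN; have h : 0 < o `^ (p * (1 - q^-1)) by rewrite powR_gt0.
  by field; rewrite gt_eqF.
have oB0 : 0 < o * B `^ q^-1 by rewrite mulr_gt0 ?powR_gt0.
have Y0 : 0 < Y by rewrite YE !mulr_gt0 ?powR_gt0.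
split.
  apply: (@le_trans _ _ (c1^-1 * Y)); last by rewrite ler_pM2r// lerDl mulr_ge0// ltW.
  rewrite ler_pdivlMl// YE mulrCA -[X in _ <= X]mulrA ler_pM2l// ler_pM2r ?powR_gt0//.
  by rewrite (ge0_ler_powR (ltW iq1)) ?nnegrE ?powR_ge0 ?(ltW nu0).
move=> n; apply: (@le_trans _ _ (36 * C * Y)); last first.
  by rewrite ler_pM2r// lerDr invr_ge0 ltW.
have three r : 1 < r -> 3 `^ r^-1 <= 3 :> R.
  move=> r1; rewrite -[X in _ <= X]powRr1//.
  by rewrite ler_powR ?invf_le1 ?(ltW r1) ?ler1n ?(lt_trans ltr01 r1).
apply: (@le_trans _ _ (36 * (o * B `^ q^-1) *
    \sum_(1 <= m < n) Num.min 1 ((nu / m%:R) `^ p^-1) * m%:R `^ (- q^-1))); last first.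
  rewrite -!mulrA ler_pM2l// YE.
  apply: le_trans (ler_wpM2l (ltW o0) (ler_wpM2l (powR_ge0 _ _) (HC nu n nu_ge))) _.
  by rewrite le_eqVlt; apply/orP; left; apply/eqP; ring.
rewrite mulr_sumr; apply: ler_sum_nat => m /andP[m0 _].
have mgt0 : 0 < m%:R :> R by rewrite ltr0n.
have rB : weak_rate q B m <= 6 * (B `^ q^-1 * m%:R `^ (- q^-1)).
  rewrite /weak_rate -mulrA powRM ?divr_ge0 ?(ltW B0) ?(ltW mgt0)//.
  rewrite powRM ?invr_ge0 ?(ltW B0) ?(ltW mgt0)//.
  rewrite -[m%:R^-1]powR_inv1 ?(ltW mgt0)// -powRrM mulN1r.
  have := three q q1; have := powR_ge0 B q^-1; have := powR_ge0 m%:R (- q^-1).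
  move: (3 `^ _) (B `^ _) (m%:R `^ _) => x y z z0 y0 x3.
  have yz0 : 0 <= y * z by rewrite mulr_ge0.
  nra.
have rA : Num.min o (weak_rate p A m) <= 6 * (o * Num.min 1 ((nu / m%:R) `^ p^-1)).
  have -> : weak_rate p A m = 2 * 3 `^ p^-1 * (o * (nu / m%:R) `^ p^-1).
    rewrite /weak_rate AE.
    have -> : 3 * (nu * o `^ p) / m%:R = 3 * (o `^ p * (nu / m%:R)) by field; rewrite gt_eqF.
    rewrite powRM ?mulr_ge0 ?invr_ge0 ?(ltW nu0) ?(ltW A0) ?(ltW op0) ?(ltW mgt0)//.
    rewrite powRM ?mulr_ge0 ?invr_ge0 ?(ltW nu0) ?(ltW A0) ?(ltW op0) ?(ltW mgt0)//.
    by rewrite -powRrM mulfV ?gt_eqF// powRr1 ?(ltW o0)// mulrA.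
  have := three p p1; have := powR_ge0 (nu / m%:R) p^-1; have := powR_ge0 3 p^-1.
  move: (3 `^ _) ((nu / m%:R) `^ _) => x y x0 y0 x3.
  have oy : 0 <= o * y by rewrite mulr_ge0// ltW.
  by have [y1|y1] := leP 1 y; rewrite ge_min; apply/orP; [left|right]; nra.
apply: le_trans (ler_pM _ _ rA rB) _; first by rewrite le_min weak_rate_ge0 ltW.
  exact: weak_rate_ge0.
by rewrite le_eqVlt; apply/orP; left; apply/eqP; ring.
Qed.

(** The level [d] is split in halves. The excess of [o * y] over d/2 is governed by the weak bound
    at level d/(2o). Each [j w] is at most [K], so the excess over d/2 vanishes if K <= d/2;
    otherwise its total is at most K <= K (2K/d)^(q - 1). *)
Lemma sum_truncated_le (T : eqType) (s : seq T) (D y j : T -> R) q B o K d :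
  1 < q -> 0 < o -> 0 <= K -> 0 < d -> (forall w, 0 <= j w) ->
  (forall w, w \in s -> D w <= o * y w + j w) ->
  weak_sum q B y s -> \sum_(w <- s) j w <= K ->
  \sum_(w <- s) Num.max (D w - d) 0 <=
    d `^ (1 - q) * (2 `^ (q - 1) * (o * (B * o `^ (q - 1)) + K `^ q)).
Proof.
move=> q1 o0 K0 d0 j0 HD ys jK.
have e0 : 0 < d / (2 * o) by rewrite divr_gt0 ?mulr_gt0.
apply: (@le_trans _ _ (\sum_(w <- s) (o * Num.max (y w - d / (2 * o)) 0 +
    Num.max (j w - d / 2) 0))).
  rewrite big_seq [X in _ <= X]big_seq; apply: ler_sum => w ws.
  have := HD w ws.
  have m1 : y w - d / (2 * o) <= Num.max (y w - d / (2 * o)) 0 by rewrite le_max lexx.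
  have m2 : j w - d / 2 <= Num.max (j w - d / 2) 0 by rewrite le_max lexx.
  have m3 : 0 <= Num.max (y w - d / (2 * o)) 0 by rewrite le_max lexx orbT.
  have m4 : 0 <= Num.max (j w - d / 2) 0 by rewrite le_max lexx orbT.
  have oE : o * (d / (2 * o)) = d / 2 by field; rewrite gt_eqF.
  move: m1 m3; set M := Num.max _ _ => m1 m3 hD.
  have om := ler_wpM2l (ltW o0) m1; rewrite mulrBr oE in om.
  have oM : 0 <= o * M by rewrite mulr_ge0// ltW.
  by rewrite ge_max; apply/andP; split; lra.
rewrite big_split/= -mulr_sumr mulrDr mulrDr; apply: lerD.
  apply: le_trans (ler_wpM2l (ltW o0) (ys _ e0)) _.
  rewrite le_eqVlt; apply/orP; left; apply/eqP.
  rewrite invfM mulrA powRM ?invr_ge0 ?divr_ge0 ?(ltW d0) ?(ltW o0)//.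
  rewrite powRM ?invr_ge0 ?(ltW d0) ?(ltW o0)//.
  rewrite -[(o^-1)]powR_inv1 ?(ltW o0)// -[2^-1]powR_inv1// -!powRrM.
  by rewrite !mulN1r !opprB; ring.
have [Kd|dK] := leP K (d / 2).
  rewrite big_seq big1 ?mulr_ge0 ?powR_ge0// => w ws.
  apply/max_idPr; rewrite subr_le0; apply: le_trans Kd; apply: le_trans jK.
  by rewrite (perm_big _ (perm_to_rem ws)) big_cons/= lerDl sumr_ge0.
have Kgt0 : 0 < K by rewrite (lt_trans _ dK)// divr_gt0.
apply: (@le_trans _ _ K).
  apply: le_trans jK; apply: ler_sum => w _; rewrite ge_max j0 andbT.
  by rewrite gerBl divr_ge0// ltW.
rewrite -(mulr_powRB1 K0 (lt_trans ltr01 q1)).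
rewrite !mulrA [_ * K]mulrC -!mulrA -[X in X <= _]mulr1 ler_pM2l//.
rewrite -[1 - q]opprB powRN ler_pdivlMl ?powR_gt0// mulr1.
rewrite -powRM//; apply: ge0_ler_powR; rewrite ?nnegrE ?subr_ge0 ?(ltW q1) ?(ltW d0) ?mulr_ge0//.
lra.
Qed.

(** Both powers are at most y^q. Applied with y = C Y, this yields the factor 2 of the final
    constant. *)
Lemma powR_mean_le q x y : 0 < q -> 0 <= x -> x <= y ->
  2 `^ (q - 1) * (x `^ q + y `^ q) <= (2 * y) `^ q.
Proof.
move=> q0 x0 xy; have y0 : 0 <= y by exact: le_trans xy.
have xyq : x `^ q <= y `^ q by rewrite (ge0_ler_powR (ltW q0)).
rewrite powRM// -(mulr_powRB1 (ler0n R 2) q0) [2 * _]mulrC -mulrA.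
by rewrite ler_wpM2l ?powR_ge0//; lra.
Qed.

Lemma sup_pTV_ge0 (W : normedModType R) p (h : R -> W) a b : a <= b ->
  (0 <= sup_pTV p h a b)%E.
Proof.
move=> ab; apply: le_trans (_ : ((1 `^ (p - 1))%:E * truncated_variation 1 h a b <= _)%E).
  rewrite mule_ge0 ?lee_fin ?powR_ge0//; apply: ereal_sup_ubound.
  by exists a, [::]; split=> //=; rewrite big_geq.
by apply: ereal_sup_ubound; exists 1 => //=; exact: ltr01.
Qed.

Lemma norm_pTV_le (W : normedModType R) (I : R -> W) q a b X :
  a <= b -> 1 < q -> 0 <= X ->
  (forall d x s, 0 < d -> a <= x -> path <%R x s -> last x s <= b ->
    \sum_(w <- zip (x :: s) s) Num.max (`|I w.2 - I w.1| - d) 0 <=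
      d `^ (1 - q) * X `^ q) ->
  (norm_pTV q I a b <= X%:E)%E.
Proof.
move=> ab q1 X0 h; have q0 : 0 < q by lra.
have h1 : (sup_pTV q I a b <= (X `^ q)%:E)%E.
  apply: ge_ereal_sup => _ [d d0 <-].
  apply: (@le_trans _ _ ((d `^ (q - 1))%:E * (d `^ (1 - q) * X `^ q)%:E)%E).
    apply: lee_wpmul2l; first by rewrite lee_fin powR_ge0.
    apply: ge_ereal_sup => _ [x [s [ax xs sb ->]]]; rewrite lee_fin.
    rewrite (big_zip_nth _ _ (fun u v => Num.max (`|I v - I u| - d) 0)).
    exact: h.
  rewrite -EFinM lee_fin -[1 - q]opprB powRN mulrA mulfV ?mul1r//.
  by rewrite gt_eqF// powR_gt0.
rewrite /norm_pTV (_ : X = (X `^ q) `^ q^-1); last first.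
  by rewrite -powRrM mulfV ?gt_eqF// powRr1.
rewrite -poweR_EFin; apply: gt0_ler_poweR => //.
- by rewrite invr_ge0 ltW.
- by rewrite in_itv/= sup_pTV_ge0 ?leey.
- by rewrite in_itv/= lee_fin powR_ge0 leey.
Qed.

End integral_variation.

(** * Increments of the integral along a list of points *)

Lemma cvg_sum_norm (R : realType) (V : normedModType R) (T : eqType) (s : seq T)
    (u : T -> nat -> V) (l : T -> V) :
  (forall w, w \in s -> u w n @[n --> \oo] --> l w) ->
  \sum_(w <- s) `|u w n| @[n --> \oo] --> \sum_(w <- s) `|l w|.
Proof.
elim: s => [_|w s IH h].
  rewrite big_nil; under eq_fun do rewrite big_nil; exact: cvg_cst.
rewrite big_cons; under eq_fun do rewrite big_cons.
apply: cvgD; first by apply: cvg_norm; apply: h; rewrite mem_head.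
by apply: IH => z zs; apply: h; rewrite inE zs orbT.
Qed.

Lemma mem_zip_path (R : realType) (x : R) s w : path <%R x s ->
  w \in zip (x :: s) s -> [/\ x <= w.1, w.1 < w.2 & w.2 <= last x s].
Proof.
elim: s x => //= y s IH x /andP[xy ys]; rewrite inE => /predU1P[->/=|ws].
  split => //; elim: (s) (y) ys {IH} => //= z r IH v /andP[vz zr].
  by rewrite (le_trans (ltW vz))// IH.
by have [h1 h2 h3] := IH y ys ws; split => //; rewrite (le_trans _ h1)// ltW.
Qed.

Section increments.
Variables (R : realType) (E V : completeNormedModType R).
Variables (F : R -> clin E V) (g : R -> E) (p q a b : R).
Hypothesis intF : forall t, t \in `[a, b] -> exists v : V, is_RS_integral F g a t v.

Lemma RS_integral_cvg_increment s t : a <= s -> s < t -> t <= b ->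
  lsum F g s (rcons (uniform_points n s t) t) @[n --> \oo] -->
    RS_integral F g a t - RS_integral F g a s.
Proof.
move=> as_ st tb.
have h u : a <= u -> u <= b -> is_RS_integral F g a u (RS_integral F g a u).
  by move=> au ub; apply: getPex; apply: intF; rewrite in_itv/= au.
have sb : s <= b by rewrite (le_trans _ tb)// ltW.
have at_ : a <= t by rewrite (le_trans as_)// ltW.
exact: (RS_integral_increment as_ st (h s as_ sb) (h t at_ tb)).
Qed.

(** For the degenerate case where [F] vanishes or [g] is constant on [a, b]: all left sums are 0,
    hence so are the increments of the integral. *)
Lemma RS_integral_constant :
  (forall x y z, x \in `[a, b] -> y \in `[a, b] -> z \in `[a, b] -> F x (g y - g z) = 0) ->
  forall d x s, 0 < d -> a <= x -> path <%R x s -> last x s <= b ->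
    \sum_(w <- zip (x :: s) s)
      Num.max (`|RS_integral F g a w.2 - RS_integral F g a w.1| - d) 0 = 0.
Proof.
move=> F0 d x s d0 ax xs sb; rewrite big_seq big1// => w ws.
have [xw ww wl] := mem_zip_path xs ws.
have aw := le_trans ax xw; have wb := le_trans wl sb.
have := RS_integral_cvg_increment aw ww wb.
have -> : (fun n => lsum F g w.1 (rcons (uniform_points n w.1 w.2) w.2)) = cst 0.
  apply/funext => n; rewrite /lsum big_seq big1//= => z zs.
  have [h1 h2] := mem_zip_path (path_uniform n ww) zs; rewrite last_rcons => h3.
  apply: F0; rewrite in_itv/=; apply/andP; split; lra.
move=> /(cvg_unique _ (cvg_cst _)) <- //.
by rewrite normr0 sub0r; apply/max_idPr; rewrite oppr_le0 ltW.
Qed.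

(** An increment of the integral is [F w.1 (g w.2 - g w.1)], at most [o] times an increment of [g],
    plus a remainder. The remainders are limits along uniform refinements, and [sum_refine_le]
    bounds their total by [K] uniformly in the refinement. *)
Lemma RS_integral_truncated_le A B o K d x s : 1 < p -> 1 < q ->
  0 < A -> 0 < B -> 0 < o -> tv_bound p A F a b -> tv_bound q B g a b ->
  (forall u w, a <= u -> u <= w -> w <= b -> `|F w - F u| <= o) ->
  (forall u, a <= u -> u <= b -> `|F u| <= o) ->
  (forall n, \sum_(1 <= m < n) Num.min o (weak_rate p A m) * weak_rate q B m <= K) ->
  0 < d -> a <= x -> path <%R x s -> last x s <= b ->
  \sum_(w <- zip (x :: s) s)
      Num.max (`|RS_integral F g a w.2 - RS_integral F g a w.1| - d) 0 <=
    d `^ (1 - q) * (2 `^ (q - 1) * (o * (B * o `^ (q - 1)) + K `^ q)).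
Proof.
move=> p1 q1 A0 B0 o0 tvF tvg Fo Fa HK d0 ax xs sb.
have p0 : 0 < p by lra.
have q0 : 0 < q by lra.
have K0 : 0 <= K by have := HK 0%N; rewrite big_geq.
pose I := RS_integral F g a.
pose j (w : R * R) := `|I w.2 - I w.1 - F w.1 (g w.2 - g w.1)|.
have ab w : w \in zip (x :: s) s -> [/\ a <= w.1, w.1 < w.2 & w.2 <= b].
  move=> /(mem_zip_path xs)[h1 h2 h3]; split=> //; first exact: le_trans h1.
  exact: le_trans sb.
apply: (@sum_truncated_le _ _ _ _ (fun w => `|g w.2 - g w.1|) j q B o K d) => //.
- by move=> w; rewrite /j.
- move=> w /ab[h1 h2 h3].
  rewrite -/(I _) -/(I _) -{1}(subrKC (F w.1 (g w.2 - g w.1)) (I w.2 - I w.1)).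
  rewrite (le_trans (ler_normD _ _))// lerD2r (le_trans (clin_norm_le _ _))//.
  by rewrite ler_wpM2r// Fa// (le_trans _ h3)// ltW.
- by apply: tvg => //; exact: path_ltW.
have c : \sum_(w <- zip (x :: s) s)
    `|lsum F g w.1 (rcons (uniform_points n w.1 w.2) w.2) - F w.1 (g w.2 - g w.1)|
    @[n --> \oo] --> \sum_(w <- zip (x :: s) s) j w.
  apply: cvg_sum_norm => w /ab[h1 h2 h3].
  apply: cvgB; last exact: cvg_cst.
  exact: RS_integral_cvg_increment.
apply: (cvgr_to_le c); apply: nearW => n.
apply: (sum_refine_le p0 q0 A0 B0 tvF tvg) HK => //.
by move=> u v; exact: path_uniform.
Qed.

End increments.

(** * The estimate for f - f(a), with its degenerate cases *)

Theorem theorem3 (R : realType) (p q : R) (hp : 1 < p) (hq : 1 < q)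
    (hpq : 1 < p^-1 + q^-1) :
  exists D : R,
    forall (E V : completeNormedModType R) (a b : R)
      (f : R -> clin E V) (g : R -> E),
      a < b ->
      Up p a b f -> Up q a b g ->
      discontinuities f a b `&` discontinuities g a b = set0 ->
      (forall t, t \in `[a, b] ->
         exists v : V, is_RS_integral (fun s => f s - f a) g a t v) /\
      (norm_pTV q (fun t => RS_integral (fun s => f s - f a)%R g a t) a b <=
         D%:E * norm_pTV p f a b `^ (p - p / q)%R
              * norm_osc f a b `^ (1 + p / q - p)%R
              * norm_pTV q g a b)%E.
Proof.
have [C C0 HC] := sum_min_weak_rate_le hp hq hpq.
exists (2 * C) => E V a b f g ltab fU gU disc.
have ab := ltW ltab; have p0 : 0 < p by lra.
have q0 : 0 < q by lra.
pose F s := f s - f a.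
have FB x y : F x - F y = f x - f y by rewrite /F opprB addrA subrK.
have fin (W : normedModType R) r (h : R -> W) : Up r a b h -> sup_pTV r h a b \is a fin_num.
  by move=> hU; rewrite ge0_fin_numE// sup_pTV_ge0.
pose A := fine (sup_pTV p f a b); pose B := fine (sup_pTV q g a b).
have A0 : 0 <= A by rewrite fine_ge0// sup_pTV_ge0.
have B0 : 0 <= B by rewrite fine_ge0// sup_pTV_ge0.
have tvF : tv_bound p A F a b.
  move=> x s ax xs sb d d0; under eq_bigr do rewrite FB.
  exact: Up_tv_bound.
have tvg : tv_bound q B g a b by exact: Up_tv_bound.
have oscle u w : a <= u -> u <= w -> w <= b -> `|f w - f u| <= 2 * A `^ p^-1.
  by move=> au uw wb; rewrite -FB; exact: (tv_bound_osc p0 tvF).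
have osc_ub : (norm_osc f a b <= (2 * A `^ p^-1)%:E)%E.
  apply: ge_ereal_sup => _ [u [w [au uw wb ->]]].
  by rewrite lee_fin distrC oscle// ltW.
have osc_ge0 : (0 <= norm_osc f a b)%E.
  apply: le_trans (_ : (`|f a - f b|%:E <= _)%E); first by rewrite lee_fin.
  by apply: ereal_sup_ubound; exists a, b.
have osc_fin : norm_osc f a b \is a fin_num.
  by rewrite ge0_fin_numE// (le_lt_trans osc_ub)// ltry.
pose o := fine (norm_osc f a b).
have o0 : 0 <= o by exact: fine_ge0.
have oA : o <= 2 * A `^ p^-1 by rewrite -lee_fin fineK.
have Fo u w : a <= u -> u <= w -> w <= b -> `|F w - F u| <= o.
  move=> au; rewrite le_eqVlt => /predU1P[-> _|uw wb]; first by rewrite subrr normr0.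
  rewrite FB distrC -lee_fin fineK//; apply: ereal_sup_ubound.
  by exists u, w.
have Fa u : a <= u -> u <= b -> `|F u| <= o.
  by move=> au ub; rewrite -[F u]subr0 -(subrr (f a)); exact: Fo.
have discF : discontinuities F a b `&` discontinuities g a b = set0.
  rewrite -subset0 -disc => t [[tab Ft] gt]; split => //; split => // ft; apply: Ft.
  by apply: cvgB => //; exact: cvg_cst.
have intF t : t \in `[a, b] -> exists v : V, is_RS_integral F g a t v.
  rewrite in_itv/= => /andP[at_ tb].
  (* Existence asks for positive bounds while [A] and [B] may vanish, so both are enlarged. *)
  have A1 : 0 < A + 1 by rewrite ltr_wpDl.
  have B1 : 0 < B + 1 by rewrite ltr_wpDl.
  apply: (RS_integral_exists p0 q0 A1 B1 _ _ hpq discF at_ tb).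
    by apply: tv_boundW tvF; rewrite lerDl.
  by apply: tv_boundW tvg; rewrite lerDl.
split=> //.
pose Y := A `^ (1 - q^-1) * o `^ (1 + p / q - p) * B `^ q^-1.
have Y0 : 0 <= Y by rewrite !mulr_ge0 ?powR_ge0.
(* All factors are finite, and (1/p)(p - p/q) = 1 - 1/q. *)
have -> : ((2 * C)%:E * norm_pTV p f a b `^ (p - p / q)%R
    * norm_osc f a b `^ (1 + p / q - p)%R * norm_pTV q g a b)%E = (2 * C * Y)%:E.
  rewrite /norm_pTV -(fineK (fin _ _ _ fU)) -(fineK (fin _ _ _ gU)) -(fineK osc_fin).
  rewrite -/A -/B -/o !poweR_EFin -!EFinM -powRrM /Y !mulrA.
  by congr (_ * _ `^ _ * _ * _)%:E; field; rewrite !gt_eqF.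
have D0 : 0 <= 2 * C by rewrite mulr_ge0 ?ler0n ?(ltW C0).
apply: norm_pTV_le => //; first exact: mulr_ge0.
move=> d x s d0 ax xs sb.
(* If o B = 0, then [F] vanishes on [a, b] or [g] is constant there. Otherwise [o], [B] and then [A]
   are positive, as [HC] demands. *)
have [oB|oB] := eqVneq (o * B) 0.
  rewrite (RS_integral_constant intF)// ?mulr_ge0 ?powR_ge0//.
  move=> y z w; rewrite !in_itv/= => /andP[ay yb] /andP[az zb] /andP[aw wb].
  change (F y (g z - g w) = 0).
  move/eqP: oB; rewrite mulf_eq0 => /orP[/eqP oE|/eqP BE].
    have : `|F y| <= 0 by rewrite -oE Fa.
    by rewrite normr_le0 => /eqP ->.
  have gE u v : a <= u -> u <= v -> v <= b -> g v = g u.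
    move=> au uv vb; have := tv_bound_osc q0 tvg au uv vb.
    rewrite BE powR0 ?mulr0 ?normr_le0 ?subr_eq0 ?invr_eq0 ?gt_eqF// => /eqP//.
  have -> : g z = g w by have [zw|/ltW wz] := leP z w; [rewrite (gE z w)|rewrite (gE w z)].
  by rewrite subrr; exact: raddf0.
move: oB; rewrite mulf_eq0 negb_or => /andP[on Bn].
have ogt0 : 0 < o by rewrite lt_neqAle eq_sym on.
have Bgt0 : 0 < B by rewrite lt_neqAle eq_sym Bn.
have Agt0 : 0 < A.
  rewrite lt_neqAle A0 andbT; apply/eqP => AE.
  by move: oA; rewrite -AE powR0 ?mulr0 ?invr_eq0 ?gt_eqF// leNgt ogt0.
have [oBY HK] := HC A B o Agt0 Bgt0 ogt0 oA.
apply: (le_trans (RS_integral_truncated_le (p := p) intF hp hq Agt0 Bgt0 ogt0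
  tvF tvg Fo Fa HK d0 ax xs sb)).
rewrite ler_wpM2l ?powR_ge0// -/Y; rewrite -/Y in oBY.
have CY0 : 0 <= C * Y by rewrite mulr_ge0// ltW.
(* The first summand becomes the q-th power of o B^(1/q), which is at most C Y. *)
have -> : o * (B * o `^ (q - 1)) = (o * B `^ q^-1) `^ q.
  rewrite powRM ?powR_ge0// -powRrM mulVf ?gt_eqF// powRr1//.
  by rewrite -(mulr_powRB1 o0 q0); ring.
have X0 : 0 <= o * B `^ q^-1 by exact: mulr_ge0 o0 (powR_ge0 _ _).
rewrite -(mulrA 2 C Y); exact: powR_mean_le q0 X0 oBY.
Qed.
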